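(* Let $X\in\{B,C\}$, $n\ge 1$, let $\lambda=(\lambda_1\ge\cdots\ge\lambda_n\ge 0)$ be a partition, $\rho=(n-1,n-2,\dots,0)$, and $w\in W$. Let $Z(\mathfrak S^X_{\lambda,w};\mathbf z)$ be the partition function of the colored lattice model $\mathfrak S^X_{\lambda,w}$, and let $D_w(\mathbf z,\lambda)$ be the type $X_n$ Demazure character. Then $$Z(\mathfrak S^X_{\lambda,w};\mathbf z)=\mathbf z^{\rho}D_w(\mathbf z,\lambda).$$
   Context: **Weyl group.** $W$ is the group of signed permutations: permutations $w$ of $\{1,\dots,n,\bar n,\dots,\bar 1\}$ with $w(\bar\imath)=\overline{w(i)}$ ($\bar{\bar\imath}=i$), with composition of functions as product. For $i<n$, $s_i$ swaps $i\leftrightarrow i+1$ (and $\bar\imath\leftrightarrow\overline{i+1}$); $s_n$ swaps $n\leftrightarrow\bar n$. $W$ acts on $\mathbf z=(z_1,\dots,z_n)$ by: $s_i\mathbf z$ ($i<n$) interchanges $z_i,z_{i+1}$; $s_n\mathbf z$ replaces $z_n$ by $z_n^{-1}$. For $\mu\in\mathbb Z^n$, $\mathbf z^\mu=\prod z_i^{\mu_i}$. **Demazure characters.** On Laurent polynomials put $\pi_i f(\mathbf z)=\frac{f(\mathbf z)-z_i^{-1}z_{i+1}f(s_i\mathbf z)}{1-z_i^{-1}z_{i+1}}$ for $i<n$; $\pi_n f(\mathbf z)=\frac{f(\mathbf z)-z_n^{-1}f(s_n\mathbf z)}{1-z_n^{-1}}$ in type $B$; $\pi_n f(\mathbf z)=\frac{f(\mathbf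 z)-z_n^{-2}f(s_n\mathbf z)}{1-z_n^{-2}}$ in type $C$. They satisfy the braid relations. For a reduced word $w=s_{i_1}\cdots s_{i_k}$, $D_w(\mathbf z,\lambda)=\pi_{i_1}\cdots\pi_{i_k}\mathbf z^\lambda$. **Colors.** There are $2n$ colors, ordered $c_1>c_2>\cdots>c_n>\overline{c}_n>\cdots>\overline{c}_1$; bar is an involution on colors, and $c_{\bar k}:=\overline{c}_k$. A spin is a color or $0$. **Grid.** There are $2n$ horizontal rows numbered $1,\dots,2n$ from top to bottom and $m\ge\lambda_1+n$ columns numbered $0,1,\dots,m-1$ from right to left. Row $2i-1$ is a $\Gamma$ row with parameter $z_i$; row $2i$ is a $\Delta$ row with parameter $z_i^{-1}$. The right ends of rows $2i-1$ and $2i$ are joined by a U-turn with parameter $z_i$, with top spin (right end of row $2i-1$) and bottom spin (right end of row $2i$). **Vertex weights.** Write the spins at a vertex as (left, top, right, bottom); $c>c'$ are any colors, $d$ any color, $z$ the parameter of the row. Unlisted weights are $0$. $\Gamma$: $(0,0,0,0)\mapsto1$; $(c,c',c',c)\mapsto z$; $(c,c',c,c')\mapsto z$; $(d,d,d,d)\mapsto z$; $(d,0,d,0)\mapsto z$; $(0,d,d,0)\mapsto1$; $(d,0,0,d)\mapsto z$. $\Delta$: $(0,0,0,0)\mapsto z$; $(c,c,c',c')\mapsto1$; $(c',c,c',c)\mapsto1$; $(d,d,d,d)\mapsto1$; $(d,0,d,0)\mapsto1$; $(d,d,0,0)\mapsto1$; $(0,0,d,d)\mapsto z$. U-turns (top,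 bottom), for $u\in\{c_1,\dots,c_n\}$: $(0,0)\mapsto z^{-2}$ in type $C$ and $z^{-2}+z^{-1}$ in type $B$; $(u,\overline u)\mapsto1$; $(u,u)\mapsto1$. **Boundary of $\mathfrak S^X_{\lambda,w}$.** Bottom edges are $0$; the left edge of each $\Gamma$ row is $0$; the left edge of row $2i$ is $\overline{c_{w^{-1}(i)}}$, $i=1,\dots,n$; the top edge of column $\lambda_i+n-i$ is $c_i$, and the other top edges are $0$. **Partition function.** A state assigns spins to all interior edges (including the horizontal edges ending at the U-turns); its weight is the product of all vertex and U-turn weights; $Z(\mathfrak S^X_{\lambda,w};\mathbf z)$ is the sum of the weights of all states. *)

(* Defs.v *)
From mathcomp Require Import all_boot all_order all_fingroup all_algebra.
From mathcomp Require Import mpoly.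

Set Implicit Arguments.
Unset Strict Implicit.
Unset Printing Implicit Defensive.

Import GRing.Theory.
Local Open Scope ring_scope.

Variant cartan_type := TypeB | TypeC.

(* Throughout, indices 1, ..., n are shifted to 0, ..., n - 1. *)

(** Signed permutations *)

(* (k, false) is the letter k and (k, true) is its barred version. *)
Notation signed n := ('I_n * bool)%type.

Definition sbar n (x : signed n) : signed n := (x.1, ~~ x.2).

Definition Weyl n : {set {perm signed n}} :=
  [set w : {perm signed n} | [forall x, w (sbar x) == sbar (w x)]].

Definition next_ord n (i : 'I_n) : option 'I_n := insub i.+1.

(* s_i; the last index is the one without successor. *)
Definition srefl n (i : 'I_n) (x : signed n) : signed n :=
  if next_ord i is Some j then (tperm i j x.1, x.2)
  else if x.1 == i then sbar x else x.

(* s_{i_1} o ... o s_{i_k} as a composition of functions; the product of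
   {perm _} composes in the opposite order. *)
Definition word_fun n (ss : seq 'I_n) : signed n -> signed n :=
  foldr (fun i f => srefl i \o f) id ss.

Definition reduced_word n (w : {perm signed n}) (ss : seq 'I_n) : Prop :=
  w =1 word_fun ss /\
  forall ss' : seq 'I_n, w =1 word_fun ss' -> (size ss <= size ss')%N.

(** Laurent polynomials, inside the field of rational functions *)

Notation ratfun R n := {fraction {mpoly R[n]}}.

Section Demazure.

Variables (R : idomainType) (n : nat).
Implicit Types (f : ratfun R n) (v : 'I_n -> ratfun R n).

Definition zvar (i : 'I_n) : ratfun R n := tofrac ('X_i : {mpoly R[n]}).

Definition mpoly_at (p : {mpoly R[n]}) v : ratfun R n :=
  mmap (fun c : R => tofrac (c%:MP_[n])) v p.

(* f(v).  The result does not depend on the chosen fraction as long as the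
   denominator does not vanish at v, in particular when v is obtained from
   zvar by an element of the Weyl group. *)
Definition ratfun_at f v : ratfun R n :=
  mpoly_at \n_(generic_quotient.repr f) v / mpoly_at \d_(generic_quotient.repr f) v.

Definition act_vars (i : 'I_n) v : 'I_n -> ratfun R n :=
  if next_ord i is Some j then fun k => v (tperm i j k)
  else fun k => if k == i then (v k)^-1 else v k.

Definition zmon (mu : 'I_n -> int) : ratfun R n := \prod_i zvar i ^ mu i.

Definition root_factor (X : cartan_type) (i : 'I_n) : ratfun R n :=
  if next_ord i is Some j then (zvar i)^-1 * zvar j
  else match X with
       | TypeB => (zvar i)^-1
       | TypeC => zvar i ^- 2
       end.

(* The formula makes sense on all rational functions and preserves Laurent
   polynomials, on which it is the usual isobaric Demazure operator. *)
Definition demazure_op (X : cartan_type) (i : 'I_n) f : ratfun R n :=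
  (f - root_factor X i * ratfun_at f (act_vars i zvar)) / (1 - root_factor X i).

Definition demazure_char (X : cartan_type) (lam : 'I_n -> nat)
    (ss : seq 'I_n) : ratfun R n :=
  foldr (demazure_op X) (zmon (fun i => (lam i)%:Z)) ss.

End Demazure.

(** Colors and spins *)

(* The color c_k is (k, false) and its bar is (k, true). *)
Notation color n := (signed n).
Notation spin n := (option (color n)).

Definition color_rank n (c : color n) : nat :=
  if ~~ c.2 then (n.*2 - c.1.+1)%N else c.1.

Definition color_lt n (c c' : color n) : bool :=
  (color_rank c < color_rank c')%N.

(** Boltzmann weights, with spins listed as left, top, right, bottom *)

Section Weights.

Variables (K : fieldType) (n : nat).

Definition Gamma_wt (z : K) (l t r b : spin n) : K :=
  match l, t, r, b with
  | None, None, None, None => 1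
  | Some cl, Some ct, Some cr, Some cb =>
      if color_lt ct cl && (cr == ct) && (cb == cl) then z
      else if color_lt ct cl && (cr == cl) && (cb == ct) then z
      else if (ct == cl) && (cr == cl) && (cb == cl) then z
      else 0
  | Some cl, None, Some cr, None => if cl == cr then z else 0
  | None, Some ct, Some cr, None => if ct == cr then 1 else 0
  | Some cl, None, None, Some cb => if cl == cb then z else 0
  | _, _, _, _ => 0
  end.

Definition Delta_wt (z : K) (l t r b : spin n) : K :=
  match l, t, r, b with
  | None, None, None, None => z
  | Some cl, Some ct, Some cr, Some cb =>
      if color_lt cr cl && (ct == cl) && (cb == cr) then 1
      else if color_lt cl ct && (cr == cl) && (cb == ct) then 1
      else if (ct == cl) && (cr == cl) && (cb == cl) then 1
      else 0
  | Some cl, None, Some cr, None => if cl == cr then 1 else 0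
  | Some cl, Some ct, None, None => if cl == ct then 1 else 0
  | None, None, Some cr, Some cb => if cr == cb then z else 0
  | _, _, _, _ => 0
  end.

Definition Uturn_wt (X : cartan_type) (z : K) (t b : spin n) : K :=
  match t, b with
  | None, None =>
      match X with
      | TypeB => z ^- 2 + z^-1
      | TypeC => z ^- 2
      end
  | Some ct, Some cb =>
      if ~~ ct.2 && ((cb == sbar ct) || (cb == ct)) then 1 else 0
  | _, _ => 0
  end.

End Weights.

(** The lattice model *)

(* The (2i-1)-st row, of type Gamma, is (i, false) and the 2i-th row, of type
   Delta, is (i, true).  With columns numbered from right to left, the
   vertex in column j has right edge j and left edge j + 1, so in each row
   the horizontal edge 0 ends at the U-turn and the horizontal edge m is the
   left boundary.  The vertical edges of level k lie below exactly k rows, so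
   levels 0 and 2n are the top and bottom boundaries. *)
Notation lrow n := ('I_n * bool)%type.

Record boundary n m := Boundary {
  left_bd : lrow n -> spin n;
  top_bd : 'I_m -> spin n;
  bottom_bd : 'I_m -> spin n
}.

Notation state n m :=
  ({ffun lrow n * 'I_m.+1 -> spin n} * {ffun 'I_(n.*2).+1 * 'I_m -> spin n})%type.

Section Model.

Variables (n m : nat).
Implicit Types (st : state n m) (r : lrow n) (j : 'I_m).

Definition hedge st r (k : nat) : spin n := st.1 (r, inord k).
Definition vedge st (k : nat) j : spin n := st.2 (inord k, j).

Definition rows_above r : nat := (r.1.*2 + r.2)%N.

(* States are given on all edges, with prescribed spins on the boundary. *)
Definition admissible (bd : boundary n m) st : bool :=
  [&& [forall r, hedge st r m == left_bd bd r],
      [forall j, vedge st 0 j == top_bd bd j]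
    & [forall j, vedge st n.*2 j == bottom_bd bd j]].

Definition row_wt (K : fieldType) (vertex_wt : spin n -> spin n -> spin n -> spin n -> K)
    st r : K :=
  \prod_(j < m) vertex_wt (hedge st r j.+1) (vedge st (rows_above r) j)
                          (hedge st r j) (vedge st (rows_above r).+1 j).

Definition state_wt (K : fieldType) (X : cartan_type) (z : 'I_n -> K) st : K :=
  \prod_(i < n) (row_wt (Gamma_wt (z i)) st (i, false)
               * row_wt (Delta_wt (z i)^-1) st (i, true)
               * Uturn_wt X (z i) (hedge st (i, false) 0) (hedge st (i, true) 0)).

Definition partition_fun (K : fieldType) (X : cartan_type) (z : 'I_n -> K)
    (bd : boundary n m) : K :=
  \sum_(st : state n m | admissible bd st) state_wt X z st.

(* In 0-based indices, the column lam_i + n - i of the top spin c_i is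
   lam i + n - i.+1. *)
Definition model_boundary (lam : 'I_n -> nat) (w : {perm signed n}) : boundary n m :=
  {| left_bd := fun r =>
       if r.2 then Some (sbar ((w^-1)%g (r.1, false))) else None;
     top_bd := fun j =>
       omap (fun i => (i, false))
         [pick i : 'I_n | j == (lam i + n - i.+1)%N :> nat];
     bottom_bd := fun=> None |}.

End Model.

(* Main.v *)
Require Import Defs.
From HB Require Import structures.
From mathcomp Require Import all_boot all_order all_fingroup all_algebra.
From mathcomp Require Import mpoly.
From mathcomp Require Import ring zify.

(** The partition function is read as a product of strips: the strip [i]
    consists of a Gamma row and a Delta row with parameter [z_i] and the U-turn
    that joins them, and it is an operator [T_a(z_i)] on the configurations of
    spins on a line of vertical edges, where [a] is the color that leaves the
    strip at the left end of its Delta row ([partition_funE]).  Along a reduced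
    word of [w], the theorem follows from three facts about these operators.

    If [a < b] are colors, then
      [(x - y) T_b(x) T_a(y) = x (T_a(x) T_b(y) - T_a(y) T_b(x))],
    the product being read from top to bottom ([strip_exchange]).  This is the
    Demazure operator of a simple reflection [s_i] with [i < n], conjugated by
    [z^rho].  It comes from the train argument.  There are Yang-Baxter equations
    for crossing two Gamma rows, two Delta rows, or a Delta row and a Gamma row
    that lies below it ([star_triangle_Gamma], [star_triangle_Delta],
    [star_triangle_Delta_Gamma]).  In two strips, with rows of types Gamma,
    Delta, Gamma, Delta, crossing the two middle rows gives two Gamma rows above
    two Delta rows, with nested U-turns on the right.  Crossing then the Gamma
    rows and the Delta rows exchanges the parameters; on the right the two
    nested U-turns are exchanged ([nested_Uturns_exchange]), and on the left,
    where Gamma rows are empty, only the crossing of the Delta rows acts, by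
    mixing the two orders in which [a] and [b] can leave.

    Nothing lies below the last strip, so exactly one path arrives there.  It
    either passes through the U-turn or drops from the Gamma row to the Delta
    row, in which case the possible weights form a geometric progression.
    Comparing the two colors that can leave gives the Demazure operator of
    [s_n] ([last_strip]).

    If [w] is the identity, all outgoing colors are barred, so that every path
    has to pass the U-turn of its own strip; there is a single state, whose
    weight is [z^(lambda + rho)] ([ground_state]).

    The hypothesis [a < b], as well as its analogue for [s_n], expresses that
    the next letter of the word increases the length; it holds at each step by
    the exchange condition for signed permutations ([exchange_word]).  Finally
    the substitutions in the Demazure operators have to be ring morphisms of
    rational functions, because they are applied to whole partition functions;
    this follows from their injectivity on polynomials ([mpoly_subst_invol]). *)

Set Implicit Arguments.
Unset Strict Implicit.
Unset Printing Implicit Defensive.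

Import GRing.Theory.
Local Open Scope ring_scope.

(** * Transfer matrices *)

Section FinfunSums.

Variable T : finType.

Definition fsnoc m (g : {ffun 'I_m -> T}) (x : T) : {ffun 'I_m.+1 -> T} :=
  [ffun i => oapp g x (unlift ord_max i)].

(** A finite family read at all natural numbers, so that the columns of a
    strip can be added one at a time. *)
Definition fget m (d : T) (g : {ffun 'I_m -> T}) (k : nat) : T :=
  oapp g d (insub k).

Lemma fget_ord m d (g : {ffun 'I_m -> T}) (i : 'I_m) : fget d g i = g i.
Proof. by rewrite /fget valK. Qed.

Lemma fsnoc_lt m (g : {ffun 'I_m -> T}) x (k : nat) (i : 'I_m) (j : 'I_m.+1) :
  j = i :> nat -> fsnoc g x j = g i.
Proof.
move=> eji; rewrite ffunE; have -> : j = lift ord_max i.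
  by apply: val_inj; rewrite /= /bump leqNgt ltn_ord add0n.
by rewrite liftK.
Qed.

Lemma fsnoc_max m (g : {ffun 'I_m -> T}) x : fsnoc g x ord_max = x.
Proof. by rewrite ffunE unlift_none. Qed.

Lemma fget_fsnoc_lt m d (g : {ffun 'I_m -> T}) x k :
  (k < m)%N -> fget d (fsnoc g x) k = fget d g k.
Proof.
move=> ltkm; rewrite (fget_ord d g (Ordinal ltkm)).
have ltkm1 : (k < m.+1)%N by apply: ltnW.
by rewrite (fget_ord d (fsnoc g x) (Ordinal ltkm1)) (@fsnoc_lt _ _ _ k (Ordinal ltkm)).
Qed.

Lemma fget_fsnoc_max m d (g : {ffun 'I_m -> T}) x :
  fget d (fsnoc g x) m = x.
Proof. by rewrite (fget_ord d (fsnoc g x) ord_max) fsnoc_max. Qed.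

Lemma sum_fsnoc (K : nmodType) m (F : {ffun 'I_m.+1 -> T} -> K) :
  \sum_h F h = \sum_g \sum_x F (fsnoc g x).
Proof.
rewrite pair_big /= (reindex (fun p : {ffun 'I_m -> T} * T => fsnoc p.1 p.2)) //=.
exists (fun h => ([ffun i => h (lift ord_max i)], h ord_max)) => [[g x] _|h _] /=.
  congr pair; last exact: fsnoc_max.
  by apply/ffunP=> i; rewrite !ffunE liftK.
apply/ffunP=> i; rewrite ffunE; case: unliftP => [j ->|->] //=.
by rewrite ffunE.
Qed.

End FinfunSums.

Section Transfer.

Variable K : comNzRingType.

Definition mxop (S : finType) (W : S -> S -> K) (v : S -> K) (s : S) : K :=
  \sum_r W s r * v r.

(** The product of the operators of [W 0], ..., [W m.-1], the last one
    being applied last.  It computes a strip from its right end to its left end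
    as well as the lattice from its top to its bottom. *)
Fixpoint transfer (S : finType) (W : nat -> S -> S -> K) m (v : S -> K) : S -> K :=
  if m is k.+1 then mxop (W k) (transfer W k v) else v.

Lemma eq_transfer (S : finType) (W W' : nat -> S -> S -> K) m v v' :
  (forall j s r, (j < m)%N -> W j s r = W' j s r) -> v =1 v' ->
  transfer W m v =1 transfer W' m v'.
Proof.
elim: m => [|m IHm] eqW eqv //= s; apply: eq_bigr => r _.
by rewrite eqW // IHm // => j s' r' ltj; apply: eqW; apply: ltnW.
Qed.

Lemma transfer_sum (S I : finType) (W : nat -> S -> S -> K) m
    (c : I -> K) (v : I -> S -> K) s :
  transfer W m (fun s => \sum_i c i * v i s) s = \sum_i c i * transfer W m (v i) s.
Proof.
elim: m s => [|m IHm] s //=; rewrite /mxop.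
under [LHS]eq_bigr => r _ do rewrite IHm mulr_sumr.
rewrite exchange_big; apply: eq_bigr => i _; rewrite mulr_sumr.
by apply: eq_bigr => r _; rewrite mulrCA.
Qed.

(** The train argument: a matrix that can be moved through one column can be
    moved through all of them. *)
Lemma transfer_intertwine (S : finType) (A B : nat -> S -> S -> K) (R : S -> S -> K) m v s :
  (forall j s r, (j < m)%N -> \sum_l R s l * A j l r = \sum_l B j s l * R l r) ->
  mxop R (transfer A m v) s = transfer B m (mxop R v) s.
Proof.
elim: m s => [|m IHm] s comAB //=; rewrite /mxop.
under eq_bigr do rewrite mulr_sumr.
rewrite exchange_big /=.
transitivity (\sum_r \sum_l B m s l * R l r * transfer A m v r).
  apply: eq_bigr => r _; rewrite -mulr_suml -comAB // mulr_suml.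
  by apply: eq_bigr => l _; rewrite mulrA.
rewrite exchange_big /=; apply: eq_bigr => l _.
rewrite -IHm; last by move=> j s' r' ltj; apply: comAB; apply: ltnW.
by rewrite /mxop mulr_sumr; apply: eq_bigr => r _; rewrite mulrA.
Qed.

(** States are functions on edges.  Summing over the spins on the successive
    vertical or horizontal lines of edges is a product of matrices. *)
Lemma sum_paths (S : finType) (W : nat -> S -> S -> K) m v s :
  \sum_(h : {ffun 'I_m.+1 -> S} | h (inord m) == s)
     v (h (inord 0)) * \prod_(j < m) W j (h (inord j.+1)) (h (inord j))
  = transfer W m v s.
Proof.
have Einord k : inord k = ord_max :> 'I_k.+1.
  by apply: val_inj; rewrite /= inordK.
elim: m s => [|m IHm] s.
  rewrite big_mkcond sum_fsnoc /= exchange_big /= (bigD1 s) //=.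
  rewrite [X in _ + X]big1 ?addr0 => [|x nxs]; last first.
    by rewrite big1 // => g _; rewrite Einord fsnoc_max (negPf nxs).
  rewrite (big_pred1 [ffun i : 'I_0 => s]) => [|g].
    by rewrite Einord fsnoc_max eqxx big_ord0 mulr1.
  by apply/esym/eqP/ffunP => -[].
rewrite big_mkcond sum_fsnoc /= exchange_big /= (bigD1 s) //=.
rewrite [X in _ + X]big1 ?addr0 => [|x nxs]; last first.
  by rewrite big1 // => g _; rewrite Einord fsnoc_max (negPf nxs).
rewrite /mxop; under [RHS]eq_bigr do rewrite -IHm mulr_sumr.
rewrite (exchange_big_dep xpredT) //=; apply: eq_bigr => g _.
rewrite Einord fsnoc_max eqxx (big_pred1 (g (inord m))) => [|r]; last by rewrite eq_sym.
have Esn j : (j <= m)%N -> fsnoc g s (inord j) = g (inord j).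
  by move=> lejm; apply: (@fsnoc_lt _ _ g s j); rewrite !inordK // ltnS ltnW.
rewrite big_ord_recr /= (Esn 0) // (Esn m) // (Einord m.+1) fsnoc_max.
rewrite [LHS]mulrA [LHS]mulrC; congr (_ * (_ * _)); apply: eq_bigr => j _.
by rewrite !Esn // ltnW.
Qed.

(** Two strips lying one above the other form a single strip once the spins
    on the edges between them are summed over. *)
Lemma transfer_merge (S S' V : finType) d (A : nat -> V -> S -> S -> K)
    (B : nat -> V -> S' -> S' -> K) m u u' s s' :
  \sum_(g : {ffun 'I_m -> V})
     transfer (fun j => A j (fget d g j)) m u s
     * transfer (fun j => B j (fget d g j)) m u' s'
  = transfer (fun j p q => \sum_v A j v p.1 q.1 * B j v p.2 q.2) m
      (fun p => u p.1 * u' p.2) (s, s').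
Proof.
elim: m s s' => [|m IHm] s s'.
  rewrite (big_pred1 [ffun i : 'I_0 => d]) // => g.
  by apply/esym/eqP/ffunP => -[].
rewrite sum_fsnoc exchange_big /= /mxop.
under [RHS]eq_bigr do rewrite mulr_suml.
rewrite [RHS]exchange_big /=; apply: eq_bigr => x _.
transitivity (\sum_(g : {ffun 'I_m -> V}) \sum_(p : S * S')
    A m x s p.1 * B m x s' p.2 *
    (transfer (fun j => A j (fget d g j)) m u p.1
     * transfer (fun j => B j (fget d g j)) m u' p.2)).
  apply: eq_bigr => g _; rewrite fget_fsnoc_max.
  rewrite -(pair_big xpredT xpredT (fun a b => A m x s a * B m x s' b * (_ a * _ b))) /=.
  rewrite mulr_suml; apply: eq_bigr => a _; rewrite mulr_sumr; apply: eq_bigr => b _.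
  rewrite mulrACA; congr (_ * (_ * _)); apply: eq_transfer => // j ? ? ltj;
  by rewrite fget_fsnoc_lt.
rewrite exchange_big; apply: eq_bigr => -[a b] _ /=.
by rewrite -mulr_sumr IHm.
Qed.

End Transfer.

(** * Vertices and crossings *)

Lemma color_rank_inj n : injective (@color_rank n).
Proof.
move=> [i b] [j b']; rewrite /color_rank /=; have := ltn_ord i; have := ltn_ord j.
by case: b; case: b' => /= ltj lti eij; try lia; congr pair; apply: val_inj => /=; lia.
Qed.

Lemma color_rank_eq n (c d : color n) : (c == d) = (color_rank c == color_rank d).
Proof. by rewrite (inj_eq (@color_rank_inj n)). Qed.

Section Vertices.

Variables (K : fieldType) (n : nat).
Implicit Types (l t r b s : spin n) (c d : color n) (x y z w : K).

Definition spin_rank s : nat := if s is Some c then (color_rank c).+1 else 0.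

(** [RGG], [RDD] and [RDG] are the weights of the crossing of two rows.  [L]
    lists the spins, from top to bottom, on the two edges to the left of the
    crossing and [l] those on the two edges to its right.  The weights are
    found by solving the linear system given by the Yang-Baxter equation; the
    normalization makes them polynomial in the parameters.  Here [x] belongs to
    the row that is above on the right and [y] to the other one.  In [RGG] and
    [RDD] the first summand is the case in which the spins keep their heights,
    so that the paths change rows, and the second one is the case in which the
    paths follow their rows; in [RDG] it is the other way round. *)
Definition RGG x y (L l : spin n * spin n) : K :=
  (l == L)%:R * (if (spin_rank L.2 < spin_rank L.1)%N || (L == (None, None)) then y else x)
  + (l == (L.2, L.1))%:R * (if (spin_rank L.1 < spin_rank L.2)%N then x - y else 0).

(** Paths run to the left along Delta rows. *)
Definition RDD x y (L l : spin n * spin n) : K :=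
  (L == l)%:R * (if (spin_rank l.1 < spin_rank l.2)%N || (l == (None, None)) then y else x)
  + (L == (l.2, l.1))%:R *
    (if (if l.1 is Some _ then spin_rank l.2 < spin_rank l.1 else l.2 != None)%N
        && (l.2 != None) then x - y else 0).

(** The row that is above on the right is a Delta row with parameter [w], the
    other one is a Gamma row with parameter [y].  Hence [L] lists the Gamma edge
    first and [l] lists the Delta edge first; the paths arrive at the first
    edge of each pair. *)
Definition RDG w y (L l : spin n * spin n) : K :=
  ((L.2, l.2) == (l.1, L.1))%:R *
    (if L.1 is Some _ then
       if (spin_rank L.1 < spin_rank l.1)%N then 0 else y
     else if l.1 is Some _ then y else w - y)
  + ((L.2, l.2) == (L.1, l.1))%:R *
    (if (spin_rank l.1 < spin_rank L.1)%N then y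
     else if (L.1 == None) && (l.1 != None) then w else 0).

Lemma spin_rankE s : spin_rank s = if s is Some c then (color_rank c).+1 else 0%N.
Proof. by []. Qed.

(** Each vertex has two edges through which paths arrive and two through which
    they leave.  The former allow at most two configurations of the latter, so
    that the sums over the configurations of the leaving edges are explicit:
    these are the sums evaluated by the lemmas of this section. *)
Lemma sum_supp0 (T : finType) (f F : T -> K) :
  (forall o, f o = 0) -> \sum_o f o * F o = 0.
Proof. by move=> f0; rewrite big1 // => o _; rewrite f0 mul0r. Qed.

Lemma sum_supp1 (T : finType) (f F : T -> K) p x :
  (forall o, f o = (o == p)%:R * x) -> \sum_o f o * F o = x * F p.
Proof.
move=> fE; rewrite (bigD1 p) //= fE eqxx mul1r big1 ?addr0 // => o /negPf nop.
by rewrite fE nop !mul0r.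
Qed.

Lemma sum_supp2 (T : finType) (f F : T -> K) p q x y :
  (forall o, f o = (o == p)%:R * x + (o == q)%:R * y) ->
  \sum_o f o * F o = x * F p + y * F q.
Proof.
move=> fE; under eq_bigr do rewrite fE mulrDl.
by rewrite big_split /= !(@sum_supp1 T _ F _ _ (fun=> erefl)).
Qed.

Lemma sum_RGG x y (L : spin n * spin n) (F : spin n * spin n -> K) :
  \sum_l RGG x y L l * F l
  = (if (spin_rank L.2 < spin_rank L.1)%N || (L == (None, None)) then y else x) * F L
    + (if (spin_rank L.1 < spin_rank L.2)%N then x - y else 0) * F (L.2, L.1).
Proof. exact: sum_supp2. Qed.

Lemma sum_RDD x y (l : spin n * spin n) (F : spin n * spin n -> K) :
  \sum_L RDD x y L l * F L
  = (if (spin_rank l.1 < spin_rank l.2)%N || (l == (None, None)) then y else x) * F l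
    + (if (if l.1 is Some _ then spin_rank l.2 < spin_rank l.1 else l.2 != None)%N
        && (l.2 != None) then x - y else 0) * F (l.2, l.1).
Proof. exact: sum_supp2. Qed.

Lemma sum_RDG w y s s' (F : spin n * spin n -> K) :
  \sum_o RDG w y (s, o.1) (s', o.2) * F o
  = (if s is Some _ then
       if (spin_rank s < spin_rank s')%N then 0 else y
     else if s' is Some _ then y else w - y) * F (s', s)
  + (if (spin_rank s' < spin_rank s)%N then y
     else if (s == None) && (s' != None) then w else 0) * F (s, s').
Proof. by apply: sum_supp2 => -[]. Qed.

Lemma Some_eqE (T : eqType) (a b : T) : (Some a == Some b) = (a == b).
Proof. by []. Qed.

Lemma None_eqE (T : eqType) (a : T) : ((None == Some a) = false) * ((Some a == None) = false).
Proof. by []. Qed.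

Let spinE := (xpair_eqE, Some_eqE, None_eqE, eqxx, andbF, andFb, mul0r, addr0, add0r).

Lemma sum_Gamma z l t F :
  \sum_o Gamma_wt z l t o.1 o.2 * F o
  = match l, t with
    | None, None => 1 * F (None, None)
    | None, Some d => 1 * F (Some d, None)
    | Some c, None => z * F (Some c, None) + z * F (None, Some c)
    | Some c, Some d =>
      if (color_rank d < color_rank c)%N then
        z * F (Some d, Some c) + z * F (Some c, Some d)
      else if color_rank d == color_rank c then z * F (Some c, Some c) else 0
    end.
Proof.
case: l t => [c|] [d|].
- case: ltngtP => [ltdc|ltcd|/color_rank_inj ->].
  + apply: sum_supp2 => -[[r|] [b|]] /=; rewrite ?spinE //.
    rewrite /color_lt ltdc /= (color_rank_eq d c) (ltn_eqF ltdc) /=.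
    have [->|nrd] := eqVneq r d; have [->|nbc] := eqVneq b c;
      rewrite ?eqxx /= ?(color_rank_eq d c) ?(color_rank_eq c d)
        ?(ltn_eqF ltdc) ?(gtn_eqF ltdc) /= ?mul1r ?mul0r ?addr0 ?add0r //;
    by case: ifP => _; rewrite ?mul1r ?mul0r ?addr0 ?add0r.
  + apply: sum_supp0 => -[[r|] [b|]] //=.
    by rewrite /color_lt ltnNge (ltnW ltcd) /= (color_rank_eq d c) (gtn_eqF ltcd).
  + apply: sum_supp1 => -[[r|] [b|]] /=; rewrite ?spinE //.
    by rewrite /color_lt ltnn /=; case: ifP; rewrite ?mul1r ?mul0r.
- apply: sum_supp2 => -[[r|] [b|]] //=; rewrite ?spinE ?andbT /= ?spinE // eq_sym;
  by case: ifP; rewrite ?mul1r ?mul0r.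
- apply: sum_supp1 => -[[r|] [b|]] //=; rewrite ?spinE ?andbT /= ?spinE // eq_sym;
  by case: ifP; rewrite ?mul1r ?mul0r.
- by apply: sum_supp1 => -[[r|] [b|]] //=; rewrite ?spinE ?mul1r.
Qed.

Lemma sum_Delta z r t F :
  \sum_o Delta_wt z o.1 t r o.2 * F o
  = match r, t with
    | None, None => z * F (None, None)
    | None, Some d => 1 * F (Some d, None)
    | Some c, None => 1 * F (Some c, None) + z * F (None, Some c)
    | Some c, Some d =>
      if (color_rank c < color_rank d)%N then
        1 * F (Some d, Some c) + 1 * F (Some c, Some d)
      else if color_rank d == color_rank c then 1 * F (Some c, Some c) else 0
    end.
Proof.
case: r t => [c|] [d|].
- case: ltngtP => [ltdc|ltcd|/color_rank_inj ->].
  + apply: sum_supp2 => -[[r|] [b|]] /=; rewrite ?spinE //.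
    rewrite /color_lt; have [->|nrd] := eqVneq r d.
      rewrite ltdc ltnn ?eqxx /= !(color_rank_eq d c, color_rank_eq c d).
      rewrite (gtn_eqF ltdc) (ltn_eqF ltdc) /=.
      by case: eqP => _ /=; rewrite ?mul1r ?mul0r ?addr0.
    rewrite !andbF !andFb mul0r add0r.
    have [->|nrc] := eqVneq r c; rewrite ?andbF ?mul0r //=.
    by rewrite ltdc /=; case: ifP; rewrite ?mul1r ?mul0r.
  + apply: sum_supp0 => -[[r|] [b|]] //=.
    rewrite /color_lt.
    have [->|nrd] := eqVneq r d; rewrite ?(ltnNge (color_rank c)) ?(ltnW ltcd) /=.
      by rewrite ltnn (color_rank_eq c d) (gtn_eqF ltcd).
    rewrite !andbF !andFb.
    have [->|nrc] := eqVneq r c; rewrite ?andbF //=.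
    by rewrite ltnNge (ltnW ltcd) /=.
  + apply: sum_supp1 => -[[r|] [b|]] /=; rewrite ?spinE //.
    rewrite /color_lt; have [->|nrc] := eqVneq r d.
      by rewrite ltnn ?eqxx /=; case: ifP; rewrite ?mul1r ?mul0r.
    by rewrite !andbF !andFb mul0r.
- apply: sum_supp2 => -[[r|] [b|]] //=; rewrite ?spinE ?andbT /= ?spinE //;
  by rewrite eq_sym; case: ifP; rewrite ?mul1r ?mul0r.
- apply: sum_supp1 => -[[r|] [b|]] //=; rewrite ?spinE ?andbT /= ?spinE //;
  by rewrite eq_sym; case: ifP; rewrite ?mul1r ?mul0r.
- by apply: sum_supp1 => -[[r|] [b|]] //=; rewrite ?spinE ?mul1r.
Qed.

End Vertices.

(** * Yang-Baxter equations *)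

Section YangBaxter.

Variables (K : fieldType) (n : nat).
Implicit Types (t b g s : spin n) (L l r : spin n * spin n) (x y z w : K).

Arguments Gamma_wt : simpl never.
Arguments Delta_wt : simpl never.

Ltac order_colors a b :=
  let lt := fresh "lt" in let h1 := fresh "h" in let h2 := fresh "h" in
  let h3 := fresh "h" in let h4 := fresh "h" in
  case: (ltngtP (color_rank a) (color_rank b)) => [lt|lt|/color_rank_inj lt];
  [ have h1 : (color_rank b < color_rank a)%N = false by rewrite ltnNge (ltnW lt)
  | have h1 : (color_rank a < color_rank b)%N = false by rewrite ltnNge (ltnW lt)
  | subst b]; try (have h2 := ltn_eqF lt; have h3 := gtn_eqF lt).

Ltac use_order :=
  repeat match goal with
  | h : is_true (color_rank ?a < color_rank ?b)%N |- context [(color_rank ?a < color_rank ?b)%N] => rewrite h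
  | h : (color_rank ?a < color_rank ?b)%N = false |- context [(color_rank ?a < color_rank ?b)%N] => rewrite h
  | h : (color_rank ?a == color_rank ?b) = false |- context [color_rank ?a == color_rank ?b] => rewrite h
  end.

Ltac eval_vertices e1 e2 e3 :=
  repeat first
    [ rewrite e1 /= | rewrite e2 /= | rewrite e3 /=
    | rewrite (ltnS, ltn0, ltnn, eqxx, xpair_eqE, Some_eqE, None_eqE) /=
    | progress use_order; simpl ].

(** The Yang-Baxter equation as an equality of operators: the edges through
    which the three paths enter are fixed, and [F] is an arbitrary function of
    the edges through which they leave.  Evaluating the vertices in the order
    in which the paths meet them turns both sides into explicit combinations of
    values of [F], for each relative order of the incoming colors. *)
Lemma RGG_Gamma_push x y L t (F : spin n -> spin n -> spin n -> K) :
  \sum_l RGG x y L l * (\sum_o Gamma_wt x l.1 t o.1 o.2 *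
    (\sum_p Gamma_wt y l.2 o.2 p.1 p.2 * F o.1 p.1 p.2))
  = \sum_o Gamma_wt y L.1 t o.1 o.2 * (\sum_p Gamma_wt x L.2 o.2 p.1 p.2 *
      (\sum_l RGG x y (o.1, p.1) l * F l.1 l.2 p.2)).
Proof.
move: (@sum_Gamma K n) (@sum_RGG K n) => eG eR; have eD := eG.
(* Only the evaluation rules matter; opaque weights keep rewriting fast. *)
generalize (@Gamma_wt K n) (@RGG K n) eG eD eR => {eG eD eR} G R eG eD eR.
case: L t => [[a|] [b|]] [c|].
- by order_colors a b; order_colors a c; try order_colors b c; try (exfalso; lia);
    eval_vertices eG eD eR; ring.
- by order_colors a b; eval_vertices eG eD eR; ring.
- by order_colors a c; eval_vertices eG eD eR; ring.
- by eval_vertices eG eD eR; ring.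
- by order_colors b c; eval_vertices eG eD eR; ring.
- by eval_vertices eG eD eR; ring.
- by eval_vertices eG eD eR; ring.
- by eval_vertices eG eD eR; ring.
Qed.

Lemma RDD_Delta_push x y r t (F : spin n -> spin n -> spin n -> K) :
  \sum_o Delta_wt x o.1 t r.1 o.2 * (\sum_p Delta_wt y p.1 o.2 r.2 p.2 *
      (\sum_L RDD x y L (o.1, p.1) * F L.1 L.2 p.2))
  = \sum_l RDD x y l r * (\sum_o Delta_wt y o.1 t l.1 o.2 *
    (\sum_p Delta_wt x p.1 o.2 l.2 p.2 * F o.1 p.1 p.2)).
Proof.
move: (@sum_Delta K n) (@sum_RDD K n) => eD eR; have eG := eD.
generalize (@Delta_wt K n) (@RDD K n) eG eD eR => {eG eD eR} D R eG eD eR.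
case: r t => [[a|] [b|]] [c|].
- by order_colors a b; order_colors a c; try order_colors b c; try (exfalso; lia);
    eval_vertices eG eD eR; ring.
- by order_colors a b; eval_vertices eG eD eR; ring.
- by order_colors a c; eval_vertices eG eD eR; ring.
- by eval_vertices eG eD eR; ring.
- by order_colors b c; eval_vertices eG eD eR; ring.
- by eval_vertices eG eD eR; ring.
- by eval_vertices eG eD eR; ring.
- by eval_vertices eG eD eR; ring.
Qed.

Lemma RDG_push w y g t (r : spin n) (F : spin n -> spin n -> spin n -> K) :
  \sum_o Delta_wt w o.1 t r o.2 * (\sum_q RDG w y (g, q.1) (o.1, q.2) *
    (\sum_p Gamma_wt y q.2 o.2 p.1 p.2 * F q.1 p.1 p.2))
  = \sum_o Gamma_wt y g t o.1 o.2 * (\sum_q RDG w y (o.1, q.1) (r, q.2) *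
    (\sum_p Delta_wt w p.1 o.2 q.1 p.2 * F p.1 q.2 p.2)).
Proof.
move: (@sum_Gamma K n) (@sum_Delta K n) (@sum_RDG K n) => eG eD eR.
generalize (@Gamma_wt K n) (@Delta_wt K n) (@RDG K n) eG eD eR => {eG eD eR} G D R eG eD eR.
case: g r t => [a|] [b|] [c|].
- by order_colors a b; order_colors a c; try order_colors b c; try (exfalso; lia);
    eval_vertices eG eD eR; ring.
- by order_colors a b; eval_vertices eG eD eR; ring.
- by order_colors a c; eval_vertices eG eD eR; ring.
- by eval_vertices eG eD eR; ring.
- by order_colors b c; eval_vertices eG eD eR; ring.
- by eval_vertices eG eD eR; ring.
- by eval_vertices eG eD eR; ring.
- by eval_vertices eG eD eR; ring.
Qed.

End YangBaxter.

Section RowExchange.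

Variables (K : fieldType) (n : nat).
Implicit Types (t b g s : spin n) (L l r : spin n * spin n) (x y z w : K).

Notation vertex := (spin n -> spin n -> spin n -> spin n -> K).

(** One column of two rows, as a matrix between the pairs of horizontal spins
    to its left and to its right. *)
Definition column2 (V V' : vertex) t b l r : K :=
  \sum_v V l.1 t r.1 v * V' l.2 v r.2 b.

Definition star_triangle (V V' : vertex) (R : spin n * spin n -> spin n * spin n -> K) :=
  forall t b L r, \sum_l R L l * column2 V V' t b l r
                = \sum_s column2 V' V t b L s * R s r.

Lemma sum_pin (T : finType) (f : T -> K) p : \sum_o f o * (o == p)%:R = f p.
Proof.
rewrite (bigD1 p) //= eqxx mulr1 big1 ?addr0 // => o /negPf ->.
by rewrite mulr0.
Qed.

Lemma sum_pair (A : nmodType) (T T' : finType) (f : T * T' -> A) :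
  \sum_o f o = \sum_u \sum_v f (u, v).
Proof. by rewrite pair_big; apply: eq_bigr => -[]. Qed.

Lemma sum_pin1 (T T' : finType) (f : T * T' -> K) a :
  \sum_o f o * (o.1 == a)%:R = \sum_v f (a, v).
Proof.
by rewrite sum_pair exchange_big; apply: eq_bigr => v _; rewrite sum_pin.
Qed.

Lemma sum_pin2 (T T' : finType) (f : T * T' -> K) a :
  \sum_o f o * (o.2 == a)%:R = \sum_v f (v, a).
Proof. by rewrite sum_pair; apply: eq_bigr => v _; rewrite sum_pin. Qed.

Lemma sum_pin_pair (T T' : finType) (f : T * T' -> K) (u : T) (v : T') :
  \sum_o f o * ((o.1 == u)%:R * (o.2 == v)%:R) = f (u, v).
Proof.
rewrite -[RHS](sum_pin (fun v => f (u, v))) -(sum_pin1 (fun o => f o * (o.2 == v)%:R)).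
by apply: eq_bigr => o _; ring.
Qed.

(** Taking for [F] the indicator function of a configuration of the edges
    through which the paths leave gives the equation entry by entry. *)
Lemma star_triangle_Gamma x y :
  star_triangle (@Gamma_wt K n x) (@Gamma_wt K n y) (RGG x y).
Proof.
move=> t b L [r1 r2].
have := RGG_Gamma_push x y L t
  (fun a c d => (a == r1)%:R * ((c == r2)%:R * (d == b)%:R)).
set A := LHS; set B := RHS => eqAB; transitivity A; last rewrite eqAB.
  apply: eq_bigr => l _; congr (_ * _).
  rewrite /column2 -(sum_pin1 (fun o => Gamma_wt x l.1 t o.1 o.2 * Gamma_wt y l.2 o.2 r2 b)).
  apply: eq_bigr => o _; rewrite -[LHS]mulrA; congr (_ * _).
  rewrite -(sum_pin_pair (fun p => Gamma_wt y l.2 o.2 p.1 p.2)) mulr_suml.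
  by apply: eq_bigr => p _; ring.
rewrite /B !sum_pair; apply: eq_bigr => u _.
under [RHS]eq_bigr do rewrite mulr_suml.
rewrite [RHS]exchange_big; apply: eq_bigr => v _ /=.
rewrite -(sum_pin2 (fun p => Gamma_wt y L.1 t u v * Gamma_wt x L.2 v p.1 p.2
                             * RGG x y (u, p.1) (r1, r2))).
rewrite mulr_sumr; apply: eq_bigr => p _ /=; rewrite -!mulrA; congr (_ * (_ * _)).
rewrite -(sum_pin_pair (RGG x y (u, p.1))) mulr_suml.
by apply: eq_bigr => l _; ring.
Qed.

Lemma star_triangle_Delta x y :
  star_triangle (@Delta_wt K n x) (@Delta_wt K n y) (RDD x y).
Proof.
move=> t b [L1 L2] r.
have := RDD_Delta_push x y r t
  (fun a c d => (a == L1)%:R * ((c == L2)%:R * (d == b)%:R)).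
set A := LHS; set B := RHS => eqAB; transitivity A; [symmetry | rewrite eqAB].
  rewrite /A !sum_pair; apply: eq_bigr => u _.
  under [RHS]eq_bigr do rewrite mulr_sumr.
  rewrite [RHS]exchange_big; apply: eq_bigr => v _ /=.
  rewrite -(sum_pin2 (fun p => RDD x y (L1, L2) (u, p.1) *
               (Delta_wt x u t r.1 v * Delta_wt y p.1 v r.2 p.2))).
  rewrite mulr_sumr; apply: eq_bigr => p _ /=.
  rewrite -(sum_pin_pair (fun o => RDD x y o (u, p.1))) !(mulr_sumr, mulr_suml).
  by apply: eq_bigr => l _; ring.
apply: eq_bigr => l _; rewrite [RHS]mulrC; congr (_ * _).
rewrite /column2 -(sum_pin1 (fun o => Delta_wt y o.1 t l.1 o.2 * Delta_wt x L2 o.2 l.2 b)).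
apply: eq_bigr => o _; rewrite -[RHS]mulrA; congr (_ * _).
rewrite -(sum_pin_pair (fun p => Delta_wt x p.1 o.2 l.2 p.2)) mulr_suml.
by apply: eq_bigr => p _; ring.
Qed.

Lemma star_triangle_Delta_Gamma w y :
  star_triangle (@Delta_wt K n w) (@Gamma_wt K n y) (RDG w y).
Proof.
move=> t b [g L2] [r r2].
have := RDG_push w y g t r
  (fun a c d => (a == L2)%:R * ((c == r2)%:R * (d == b)%:R)).
set A := LHS; set B := RHS => eqAB; transitivity A; [symmetry | rewrite eqAB].
  rewrite /A !sum_pair; apply: eq_bigr => u _.
  under [RHS]eq_bigr do rewrite mulr_sumr.
  rewrite [RHS]exchange_big; apply: eq_bigr => v _ /=.
  rewrite -(sum_pin1 (fun q => RDG w y (g, q.1) (u, q.2) *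
               (Delta_wt w u t r v * Gamma_wt y q.2 v r2 b))).
  rewrite mulr_sumr; apply: eq_bigr => q _ /=.
  rewrite -(sum_pin_pair (fun p => Gamma_wt y q.2 v p.1 p.2)) !(mulr_sumr, mulr_suml).
  by apply: eq_bigr => p _; ring.
rewrite /B !sum_pair; apply: eq_bigr => u _.
under [RHS]eq_bigr do rewrite mulr_suml.
rewrite [RHS]exchange_big; apply: eq_bigr => v _ /=.
rewrite -(sum_pin2 (fun q => Gamma_wt y g t u v * Delta_wt w L2 v q.1 b
                             * RDG w y (u, q.1) (r, q.2))).
rewrite mulr_sumr; apply: eq_bigr => q _ /=.
rewrite -(sum_pin_pair (fun p => Delta_wt w p.1 v q.1 p.2)) !(mulr_sumr, mulr_suml).
by apply: eq_bigr => p _; ring.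
Qed.

(** * Rows as matrices *)

Variable m : nat.
Notation config := {ffun 'I_m -> spin n}.

(** The partition function of one row, whose horizontal boundary spins are
    [l] and [r], as a matrix indexed by the configurations of vertical spins
    above and below the row. *)
Definition row_transfer (V : vertex) (l r : spin n) : 'M[K]_#|{: config}| :=
  \matrix_(i, j) transfer
    (fun k p q => V p (fget None (enum_val i) k) q (fget None (enum_val j) k))
    m (fun q => (q == r)%:R) l.

Lemma mul_row_transfer V V' l r i j :
  (row_transfer V l.1 r.1 *m row_transfer V' l.2 r.2) i j
  = transfer (fun k => column2 V V' (fget None (enum_val i) k) (fget None (enum_val j) k))
      m (fun q => (q == r)%:R) l.
Proof.
rewrite mxE; under eq_bigr do rewrite !mxE.
rewrite -(big_enum_val (fun c : config =>
   transfer (fun k p q => V p (fget None (enum_val i) k) q (fget None c k))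
     m (fun q => (q == r.1)%:R) l.1 *
   transfer (fun k p q => V' p (fget None c k) q (fget None (enum_val j) k))
     m (fun q => (q == r.2)%:R) l.2)) /=.
rewrite (transfer_merge None (fun k v p q => V p (fget None (enum_val i) k) q v)
   (fun k v p q => V' p v q (fget None (enum_val j) k))).
case: l r => [l1 l2] [r1 r2]; apply: eq_transfer => // -[q1 q2].
by rewrite xpair_eqE -mulnb natrM.
Qed.

(** The train argument for two rows. *)
Lemma row_exchange V V' R L r :
  star_triangle V V' R ->
  \sum_l R L l *: (row_transfer V l.1 r.1 *m row_transfer V' l.2 r.2)
  = \sum_s R s r *: (row_transfer V' L.1 s.1 *m row_transfer V L.2 s.2).
Proof.
move=> VV'R; apply/matrixP=> i j; rewrite !summxE.
under eq_bigr do rewrite mxE mul_row_transfer.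
under [RHS]eq_bigr do rewrite mxE mul_row_transfer.
rewrite -/(mxop R _ L) (transfer_intertwine (B := fun k =>
  column2 V' V (fget None (enum_val i) k) (fget None (enum_val j) k))) //.
rewrite -transfer_sum; apply: eq_transfer => // q.
rewrite /mxop sum_pin -[LHS](sum_pin (fun q' => R q' r) q).
by apply: eq_bigr => q' _; rewrite [q == _]eq_sym.
Qed.

End RowExchange.

(** * Passing the U-turns *)

Section Uturns.

Variables (K : fieldType) (n : nat) (X : cartan_type).
Implicit Types (t b g s : spin n) (L l r P Q : spin n * spin n) (x y z w : K).

Lemma sum_RDD_l x y L (F : spin n * spin n -> K) :
  \sum_l RDD x y L l * F l
  = (if (spin_rank L.1 < spin_rank L.2)%N || (L == (None, None)) then y else x) * F L
    + (if (if L.2 is Some _ then spin_rank L.1 < spin_rank L.2 else L.1 != None)%N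
        && (L.1 != None) then x - y else 0) * F (L.2, L.1).
Proof.
apply: sum_supp2 => l; rewrite /RDD; congr (_ + _).
  by rewrite eq_sym; have [->|_] := eqVneq l L; rewrite ?mul0r.
have -> : (L == (l.2, l.1)) = (l == (L.2, L.1)).
  by case: L l => [L1 L2] [l1 l2]; rewrite !xpair_eqE andbC ![L1 == _]eq_sym ![L2 == _]eq_sym.
by have [->|_] := eqVneq l (L.2, L.1); rewrite ?mul0r.
Qed.

Lemma sum_Uturn_bottom z s (F : spin n -> K) :
  \sum_q Uturn_wt X z s q * F q
  = match s with
    | None => @Uturn_wt K n X z None None * F None
    | Some (i, false) => F (Some (i, false)) + F (Some (i, true))
    | Some (i, true) => 0
    end.
Proof.
case: s => [[i [|]]|] /=.
- by rewrite big1 // => -[q|] _; rewrite mul0r.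
- have -> : F (Some (i, false)) + F (Some (i, true))
    = 1 * F (Some (i, false)) + 1 * F (Some (i, true)) by rewrite !mul1r.
  apply: sum_supp2 => -[[j [|]]|] /=; rewrite ?Some_eqE ?xpair_eqE ?andbF ?andbT /=.
  by rewrite orbF; case: (_ == _); rewrite ?mul1r ?mul0r ?addr0 ?add0r.
  by case: (_ == _); rewrite ?mul1r ?mul0r ?addr0 ?add0r.
  by rewrite !mul0r addr0.
by apply: sum_supp1 => -[q|] //=; rewrite ?mul0r ?mul1r.
Qed.

Lemma sum_Uturn_top z s (F : spin n -> K) :
  \sum_p Uturn_wt X z p s * F p
  = match s with
    | None => @Uturn_wt K n X z None None * F None
    | Some (i, _) => F (Some (i, false))
    end.
Proof.
case: s => [[i b]|] /=; last by apply: sum_supp1 => -[[j [|]]|] //=; rewrite ?mul0r ?mul1r.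
rewrite -[RHS]mul1r; apply: sum_supp1 => -[[j [|]]|] //=;
  rewrite ?Some_eqE ?xpair_eqE ?andbF ?andbT ?mul0r //= mulr1.
rewrite eq_sym; case: b => /=; rewrite ?andbT ?andbF ?orbF /=; by case: (_ == _).
Qed.

(** The right boundary of two strips after a crossing of the lower row of the
    first one with the upper row of the second one.  The Gamma edges are [P],
    the Delta edges are [Q]; the first U-turn joins [P.1] to the crossing and
    the second one joins the crossing to [Q.2]. *)
Definition nested_Uturns x y P Q : K :=
  \sum_l RDG x^-1 y (P.2, Q.1) l * (Uturn_wt X x P.1 l.1 * Uturn_wt X y l.2 Q.2).

Lemma nested_UturnsE x y P Q :
  nested_Uturns x y P Q =
  match P.1 with
  | Some (_, true) => 0
  | Some (i, false) =>
    match Q.2 with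
    | Some (j, _) => RDG x^-1 y (P.2, Q.1) (Some (i, false), Some (j, false))
                     + RDG x^-1 y (P.2, Q.1) (Some (i, true), Some (j, false))
    | None => @Uturn_wt K n X y None None *
              (RDG x^-1 y (P.2, Q.1) (Some (i, false), None)
               + RDG x^-1 y (P.2, Q.1) (Some (i, true), None))
    end
  | None =>
    match Q.2 with
    | Some (j, _) => @Uturn_wt K n X x None None *
                     RDG x^-1 y (P.2, Q.1) (None, Some (j, false))
    | None => @Uturn_wt K n X x None None * @Uturn_wt K n X y None None *
              RDG x^-1 y (P.2, Q.1) (None, None)
    end
  end.
Proof.
transitivity (\sum_q Uturn_wt X x P.1 q *
    \sum_p Uturn_wt X y p Q.2 * RDG x^-1 y (P.2, Q.1) (q, p)).
  rewrite /nested_Uturns sum_pair; apply: eq_bigr => q _; rewrite mulr_sumr.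
  by apply: eq_bigr => p _ /=; ring.
rewrite sum_Uturn_bottom; case: P.1 => [[i [|]]|] //; rewrite !sum_Uturn_top;
  by case: Q.2 => [[j b]|] //; ring.
Qed.

Lemma rank_lt (i j : 'I_n) (b c : bool) :
  (color_rank (i, b) < color_rank (j, c))%N
  = if b then ~~ c || (i < j)%N else ~~ c && (j < i)%N.
Proof.
have := ltn_ord i; have := ltn_ord j; rewrite /color_rank /=.
by case: b; case: c => /= ltj lti; lia.
Qed.

Lemma RDG_colors w y (i j k l : 'I_n) (b c d e : bool) :
  RDG w y (Some (j, c), Some (k, d)) (Some (i, b), Some (l, e))
  = (((i == k) && (j == l)) && ((b == d) && (c == e)))%:R *
      (if (if c then ~~ b || (j < i)%N else ~~ b && (i < j)%N) then 0 else y)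
    + (((i == l) && (j == k)) && ((b == e) && (c == d)))%:R *
      (if (if b then ~~ c || (i < j)%N else ~~ c && (j < i)%N) then y else 0).
Proof.
rewrite /RDG !xpair_eqE !Some_eqE !xpair_eqE !spin_rankE !ltnS !rank_lt.
rewrite ![k == _]eq_sym ![l == _]eq_sym ![d == _]eq_sym ![e == _]eq_sym.
by congr (_%:R * _ + _%:R * _); case: (i == _); case: (j == _); case: (b == _); case: (c == _).
Qed.

(** The case of [nested_Uturns_exchange] in which all four edges carry colors.
    Both sides depend only on the bars, on the order of the indices in each
    pair, and on whether the two pairs of indices match straight ([A]) or
    crosswise ([B]); the remaining cases are polynomial identities. *)
Lemma nested_Uturns_exchange_colors x y (i j k l : 'I_n) (b c d e : bool)
    (F := fun (i j k l : 'I_n) (b c d : bool) => (if b then 0 else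
       RDG x^-1 y (Some (j, c), Some (k, d)) (Some (i, false), Some (l, false)) +
       RDG x^-1 y (Some (j, c), Some (k, d)) (Some (i, true), Some (l, false))))
    (F' := fun (i j k l : 'I_n) (b c d : bool) => (if b then 0 else
       RDG y^-1 x (Some (j, c), Some (k, d)) (Some (i, false), Some (l, false)) +
       RDG y^-1 x (Some (j, c), Some (k, d)) (Some (i, true), Some (l, false)))) :
  x != 0 -> y != 0 ->
  (if (color_rank (j, c) < color_rank (i, b))%N then y else x) *
    ((if (color_rank (k, d) < color_rank (l, e))%N then y^-1 else x^-1) * F i j k l b c d
     + (if (color_rank (k, d) < color_rank (l, e))%N then x^-1 - y^-1 else 0) * F i j l k b c e)
  + (if (color_rank (i, b) < color_rank (j, c))%N then x - y else 0) *
    ((if (color_rank (k, d) < color_rank (l, e))%N then y^-1 else x^-1) * F j i k l c b d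
     + (if (color_rank (k, d) < color_rank (l, e))%N then x^-1 - y^-1 else 0) * F j i l k c b e)
  = y * x^-1 * F' i j k l b c d.
Proof.
move=> nzx nzy; rewrite {}/F {}/F' !RDG_colors !rank_lt.
rewrite ![(j == _) && (i == _)]andbC.
set A := (i == k) && (j == l); set B := (i == l) && (j == k).
have: [/\ ~~ ((i < j) && (j < i)), ~~ ((k < l) && (l < k)),
          A ==> ((i < j) == (k < l)) && ((j < i) == (l < k)),
          B ==> ((i < j) == (l < k)) && ((j < i) == (k < l))
        & ~~ [|| i < j, j < i, k < l | l < k] ==> (A == B)]%N.
  rewrite /A /B; split; try lia.
  - by apply/implyP => /andP[/eqP-> /eqP->]; rewrite !eqxx.
  - by apply/implyP => /andP[/eqP-> /eqP->]; rewrite !eqxx.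
  - rewrite !negb_or -!leqNgt; apply/implyP=> /and4P[ji ij lk kl].
    have -> : i = j by apply/val_inj/eqP; rewrite eqn_leq ij ji.
    have -> : k = l by apply/val_inj/eqP; rewrite eqn_leq kl lk.
    by [].
move: A B (i < j)%N (j < i)%N (k < l)%N (l < k)%N.
case; case; case; case; case; case => -[] //= _ _ _ _ _;
case: b; case: c; case: d; case: e; rewrite /=; try ring;
  by field; rewrite nzx.
Qed.

Ltac eval_ranks :=
  repeat first
    [ rewrite (ltnS, ltn0, ltnn, eqxx, rank_lt, Some_eqE, None_eqE, xpair_eqE,
               andbT, andbF, orbF, orbT) /=
    | match goal with
      | h : ?b = false |- context [?b] => rewrite h /=
      | h : is_true ?b |- context [?b] => rewrite h /=
      end ].

Ltac order_ords i j :=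
  let lt := fresh "lt" in
  case: (ltngtP i j) => [lt|lt|/val_inj ?];
  [ have ? : (j < i)%N = false by rewrite ltnNge (ltnW lt)
  | have ? : (i < j)%N = false by rewrite ltnNge (ltnW lt)
  | subst j ].

Ltac zeros := rewrite ?(mulr0, mul0r, addr0, add0r) /=.

(** The reflection equation: the crossings of the two Gamma rows and of the two
    Delta rows exchange the nested U-turns.  When one of the U-turns is empty,
    the identity rests on the fact that [x * kappa x - x^-1], where [kappa] is
    the weight of an empty U-turn, does not depend on [x]. *)
Lemma nested_Uturns_exchange x y L r : x != 0 -> y != 0 ->
  \sum_P RGG x y L P * (\sum_Q RDD x^-1 y^-1 r Q * nested_Uturns x y P Q)
  = y * x^-1 * nested_Uturns y x L r.
Proof.
move=> nzx nzy; rewrite sum_RGG !sum_RDD_l !nested_UturnsE /=.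
case: L r => [[[i b]|] [[j c]|]] [[[k d]|] [[l e]|]] /=; rewrite ?spin_rankE ?ltnS.
- have <- := @nested_Uturns_exchange_colors x y i j k l b c d e nzx nzy.
  by rewrite !orbF !andbT.
all: rewrite /RDG /=; eval_ranks; zeros; try done.
all: repeat match goal with b : bool |- _ => revert b end.
all: repeat case; rewrite /=; eval_ranks; zeros; try done.
all: repeat match goal with 
  | |- context [?i == ?j] => 
    let ne := fresh "ne" in let ne' := fresh "ne" in
    case: (eqVneq i j) => [?|/negPf ne];
    [subst j | have ne' : (j == i) = false by rewrite eq_sym]; eval_ranks; zeros; try done
  | |- context [leq (S (nat_of_ord ?i)) (nat_of_ord ?j)] => order_ords i j; eval_ranks; zeros; try done
  end.
all: case: X => /=; try by field; rewrite nzx nzy.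
Qed.

End Uturns.

(** * Exchanging two strips *)

Section StripExchange.

Variables (K : fieldType) (n m : nat) (X : cartan_type).
Implicit Types (a b : color n) (L l r P Q s : spin n * spin n) (x y z w : K).

Notation Gamma_row := (fun z => row_transfer m (@Gamma_wt K n z)).
Notation Delta_row := (fun w => row_transfer m (@Delta_wt K n w)).

Definition strip_transfer z a : 'M[K]_#|{: {ffun 'I_m -> spin n}}| :=
  \sum_o Uturn_wt X z o.1 o.2 *:
    (Gamma_row z None o.1 *m Delta_row z^-1 (Some a) o.2).

Definition Gamma_rows x y P := Gamma_row x None P.1 *m Gamma_row y None P.2.

Definition Delta_rows x y a b Q :=
  Delta_row x^-1 (Some a) Q.1 *m Delta_row y^-1 (Some b) Q.2.

(** On the left, Gamma rows carry no path, so that a crossing that involves one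
    of them has a single configuration. *)
Lemma RDG_left w y a l : RDG w y (None, Some a) l = (l == (Some a, None))%:R * y.
Proof.
case: l => [[c|] [d|]]; rewrite /RDG /= ?xpair_eqE ?Some_eqE ?eqxx /= ?andbF ?andbT;
by rewrite ?mul0r ?mulr0 ?addr0 // [a == c]eq_sym.
Qed.

Lemma RGG_left x y l : RGG x y (None, None) l = (l == (None, None))%:R * y.
Proof. by rewrite /RGG /= mulr0 addr0. Qed.

Lemma RDD_left x y a b l : color_lt a b ->
  RDD x y (Some a, Some b) l
  = (l == (Some a, Some b))%:R * y + (l == (Some b, Some a))%:R * (x - y).
Proof.
move=> ltab; rewrite -[LHS](sum_pin (fun l => RDD x y (Some a, Some b) l) l).
under eq_bigr do rewrite [_ == l]eq_sym.
by rewrite sum_RDD_l /= !ltnS -/(color_lt a b) ltab /=; ring.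
Qed.

Lemma Delta_Gamma_exchange x y a r :
  y *: (Delta_row x^-1 (Some a) r.1 *m Gamma_row y None r.2)
  = \sum_s RDG x^-1 y s r *: (Gamma_row y None s.1 *m Delta_row x^-1 (Some a) s.2).
Proof.
rewrite -(row_exchange m (None, Some a) r (star_triangle_Delta_Gamma x^-1 y)).
rewrite (bigD1 (Some a, None)) //= big1 => [|l /negPf nl]; rewrite RDG_left.
  by rewrite eqxx mul1r addr0.
by rewrite nl mul0r scale0r.
Qed.

Lemma Gamma_Gamma_exchange x y r :
  y *: Gamma_rows x y r = \sum_s RGG x y s r *: Gamma_rows y x s.
Proof.
rewrite -(row_exchange m (None, None) r (star_triangle_Gamma x y)).
rewrite (bigD1 (None, None)) //= big1 => [|l /negPf nl]; rewrite RGG_left.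
  by rewrite eqxx mul1r addr0.
by rewrite nl mul0r scale0r.
Qed.

Lemma Delta_Delta_exchange x y a b r : color_lt a b ->
  y^-1 *: Delta_rows x y a b r + (x^-1 - y^-1) *: Delta_rows x y b a r
  = \sum_s RDD x^-1 y^-1 s r *: Delta_rows y x a b s.
Proof.
move=> ltab.
have nab : (Some b, Some a) != (Some a, Some b) :> spin n * spin n.
  by rewrite xpair_eqE !Some_eqE (color_rank_eq b) (gtn_eqF ltab).
rewrite -(row_exchange m (Some a, Some b) r (star_triangle_Delta x^-1 y^-1)).
rewrite (bigD1 (Some a, Some b)) //= (bigD1 (Some b, Some a)) //= big1 => [|l].
  by rewrite addr0 !RDD_left // !eqxx [(Some a, _) == _]eq_sym (negPf nab) /=
             !mul1r !mul0r addr0 add0r.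
by case/andP=> /negPf n1 /negPf n2; rewrite RDD_left // n1 n2 !mul0r addr0 scale0r.
Qed.

(** Moving the crossing of the two middle rows from the left end to the right
    end. *)
Lemma nest_strips x y a b :
  y *: (strip_transfer x a *m strip_transfer y b)
  = \sum_P \sum_Q nested_Uturns X x y P Q *: (Gamma_rows x y P *m Delta_rows x y a b Q).
Proof.
have exch o o' : y *: ((Uturn_wt X x o.1 o.2 *: (Gamma_row x None o.1
        *m Delta_row x^-1 (Some a) o.2)) *m (Uturn_wt X y o'.1 o'.2 *:
        (Gamma_row y None o'.1 *m Delta_row y^-1 (Some b) o'.2)))
    = \sum_s (RDG x^-1 y s (o.2, o'.1)
              * (Uturn_wt X x o.1 o.2 * Uturn_wt X y o'.1 o'.2)) *:
        (Gamma_rows x y (o.1, s.1) *m Delta_rows x y a b (s.2, o'.2)).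
  transitivity ((Uturn_wt X x o.1 o.2 * Uturn_wt X y o'.1 o'.2) *:
    (Gamma_row x None o.1 *m (y *: (Delta_row x^-1 (Some a) o.2 *m Gamma_row y None o'.1))
     *m Delta_row y^-1 (Some b) o'.2)).
    rewrite -!(scalemxAl, scalemxAr) !scalerA !mulmxA; congr (_ *: _); ring.
  rewrite (Delta_Gamma_exchange x y a (o.2, o'.1)) mulmx_sumr mulmx_suml scaler_sumr.
  apply: eq_bigr => s _; rewrite -!(scalemxAl, scalemxAr) scalerA mulrC.
  by rewrite /Gamma_rows /Delta_rows !mulmxA.
rewrite /strip_transfer mulmx_suml scaler_sumr.
under eq_bigr do rewrite mulmx_sumr scaler_sumr (eq_bigr _ (fun o' _ => exch _ o')).
under [RHS]eq_bigr do under eq_bigr do rewrite /nested_Uturns scaler_suml.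
rewrite !pair_big /= [RHS](reindex (fun t : ((spin n * spin n) * (spin n * spin n)) * (spin n * spin n) =>
  (((t.1.1.1, t.2.1), (t.2.2, t.1.2.2)), (t.1.1.2, t.1.2.1)))) /=; last first.
  exists (fun t => (((t.1.1.1, t.2.1), (t.2.2, t.1.2.2)), (t.1.1.2, t.1.2.1)));
    by case=> [[[? ?] [? ?]] [? ?]].
by apply: eq_bigr => -[[[? ?] [? ?]] [? ?]] _.
Qed.

(** Moving the crossings of the Gamma rows and of the Delta rows from the left
    to the right exchanges the parameters.  The crossing of the Delta rows on
    the left contributes the term in which [a] and [b] leave in the other
    order. *)
Lemma strip_exchange x y a b : x != 0 -> y != 0 -> color_lt a b ->
  (x - y) *: (strip_transfer x b *m strip_transfer y a)
  = x *: (strip_transfer x a *m strip_transfer y b)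
    - x *: (strip_transfer y a *m strip_transfer x b).
Proof.
move=> nzx nzy ltab; set Zab := strip_transfer x a *m _.
set Zba := strip_transfer x b *m _; set Zab' := strip_transfer y a *m _.
suff E : y *: (y^-1 *: (y *: Zab) + (x^-1 - y^-1) *: (y *: Zba))
         = (y * x^-1) *: (x *: Zab').
  have -> : x *: Zab' = (x * y^-1) *: ((y * x^-1) *: (x *: Zab')).
    by rewrite !scalerA; congr (_ *: _); field; rewrite nzx nzy.
  rewrite -E !scalerDr opprD addrA !scalerA.
  have -> : x * y^-1 * y * y^-1 * y = x by field; rewrite nzy.
  have -> : x * y^-1 * y * (x^-1 - y^-1) * y = - (x - y) by field; rewrite nzx nzy.
  by rewrite subrr sub0r scaleNr opprK.
rewrite /Zab /Zba /Zab' !nest_strips.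
transitivity (\sum_P \sum_Q nested_Uturns X x y P Q *:
   ((y *: Gamma_rows x y P) *m
    (y^-1 *: Delta_rows x y a b Q + (x^-1 - y^-1) *: Delta_rows x y b a Q))).
  rewrite !scaler_sumr -big_split scaler_sumr /=; apply: eq_bigr => P _.
  rewrite !scaler_sumr -big_split scaler_sumr /=; apply: eq_bigr => Q _.
  rewrite -scalemxAl mulmxDr -!scalemxAr scalerA mulrC -scalerA; congr (_ *: _).
  by rewrite scalerDr !scalerA ![_ * nested_Uturns _ _ _ _ _]mulrC.
under eq_bigr => P _.
  under eq_bigr => Q _.
    rewrite Gamma_Gamma_exchange Delta_Delta_exchange // mulmx_suml scaler_sumr.
    under eq_bigr => s _.
      rewrite mulmx_sumr scaler_sumr.
      under eq_bigr => t _ do rewrite -scalemxAl -scalemxAr !scalerA.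
      over.
    over.
  over.
transitivity (\sum_s \sum_t (\sum_P RGG x y s P *
    (\sum_Q RDD x^-1 y^-1 t Q * nested_Uturns X x y P Q)) *:
    (Gamma_rows y x s *m Delta_rows y x a b t)).
  under eq_bigr => P _ do rewrite exchange_big.
  rewrite exchange_big; apply: eq_bigr => s _ /=.
  under eq_bigr => P _ do rewrite exchange_big.
  rewrite exchange_big; apply: eq_bigr => t _ /=.
  rewrite scaler_suml; apply: eq_bigr => P _.
  rewrite mulr_sumr scaler_suml; apply: eq_bigr => Q _; congr (_ *: _); ring.
rewrite scaler_sumr; apply: eq_bigr => s _; rewrite scaler_sumr; apply: eq_bigr => t _.
by rewrite nested_Uturns_exchange // scalerA.
Qed.

End StripExchange.

(** * The partition function as a product of strips *)

Section StateSum.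

Variables (K : fieldType) (n m : nat) (X : cartan_type).
Notation config := {ffun 'I_m -> spin n}.
Implicit Types (tau beta : config) (z : K) (a : color n).

Definition strip_column z tau beta k :=
  column2 (@Gamma_wt K n z) (Delta_wt z^-1) (fget None tau k) (fget None beta k).

(** The strip as an operator; it is [strip_transfer] with indices in the
    configurations. *)
Definition strip z a tau beta : K :=
  transfer (strip_column z tau beta) m (fun q => Uturn_wt X z q.1 q.2) (None, Some a).

Lemma strip_transferE z a i j :
  strip_transfer m X z a i j = strip z a (enum_val i) (enum_val j).
Proof.
rewrite summxE; under eq_bigr => o _ do
  rewrite mxE (mul_row_transfer _ _ (None, Some a) o).
rewrite -transfer_sum; apply: eq_transfer => // q.
by rewrite -[RHS](sum_pin (fun o => Uturn_wt X z o.1 o.2)); apply: eq_bigr => o _;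
   rewrite eq_sym.
Qed.

Notation strip_state := ({ffun 'I_m.+1 -> spin n * spin n} * config)%type.

(** A state of a strip is given by the horizontal spins of its two rows and by
    the vertical spins between them. *)
Definition strip_wt z (ho : strip_state) tau beta : K :=
  (\prod_(j < m) Gamma_wt z (ho.1 (inord j.+1)).1 (tau j) (ho.1 (inord j)).1 (ho.2 j))
  * (\prod_(j < m) Delta_wt z^-1 (ho.1 (inord j.+1)).2 (ho.2 j) (ho.1 (inord j)).2 (beta j))
  * Uturn_wt X z (ho.1 (inord 0)).1 (ho.1 (inord 0)).2.

Lemma sum_strip_wt z a tau beta :
  \sum_(ho : strip_state) (ho.1 (inord m) == (None, Some a))%:R * strip_wt z ho tau beta
  = strip z a tau beta.
Proof.
rewrite /strip -sum_paths sum_pair [RHS]big_mkcond /=; apply: eq_bigr => h _.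
case: eqP => _; last by rewrite big1 // => o _; rewrite mul0r.
under [in RHS]eq_bigr do rewrite /strip_column /column2 !fget_ord.
rewrite bigA_distr_bigA mulr_sumr /=; apply: eq_bigr => o _.
by rewrite mul1r mulrC big_split.
Qed.

(** States of the lattice correspond to families of states of the strips
    together with the vertical spins above, between and below the strips. *)
Definition glue (t : {ffun 'I_n -> strip_state} * {ffun 'I_n.+1 -> config}) : state n m :=
  ([ffun rj : lrow n * 'I_m.+1 =>
      if rj.1.2 then ((t.1 rj.1.1).1 rj.2).2 else ((t.1 rj.1.1).1 rj.2).1],
   [ffun kj : 'I_(n.*2).+1 * 'I_m =>
      if odd kj.1 then oapp (fun i => (t.1 i).2 kj.2) None (insub kj.1./2)
      else t.2 (inord kj.1./2) kj.2]).

Definition unglue (st : state n m) : {ffun 'I_n -> strip_state} * {ffun 'I_n.+1 -> config} :=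
  ([ffun i => ([ffun j => (st.1 ((i, false), j), st.1 ((i, true), j))],
               [ffun j => vedge st i.*2.+1 j])],
   [ffun k : 'I_n.+1 => [ffun j => vedge st k.*2 j]]).

Lemma glueK : cancel glue unglue.
Proof.
case=> ho e; congr pair; apply/ffunP=> i; rewrite !ffunE.
  rewrite [RHS]surjective_pairing; congr pair; apply/ffunP=> j; rewrite !ffunE /vedge /= ?ffunE /=.
    by rewrite -surjective_pairing.
  rewrite inordK /=; last by have := ltn_ord i; lia.
  by rewrite odd_double /= uphalf_double valK.
apply/ffunP=> j; rewrite !ffunE /vedge /= ffunE /= inordK; last by have := ltn_ord i; lia.
by rewrite odd_double doubleK inord_val.
Qed.

Lemma unglueK : cancel unglue glue.
Proof.
case=> h v; congr pair; apply/ffunP.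
  by case=> [[i [|]] j]; rewrite !ffunE.
case=> k j; rewrite !ffunE /=; have ltk := ltn_ord k; case: ifP => oddk.
  have lti : (k./2 < n)%N by lia.
  rewrite (insubT (fun i => (i < n)%N) lti) /= !ffunE /vedge /=; congr (v (_, _)).
  by apply: val_inj; rewrite /= inordK; lia.
rewrite /vedge /=; congr (v (_, _)).
by apply: val_inj; rewrite /= !inordK; lia.
Qed.

Implicit Types t : {ffun 'I_n -> strip_state} * {ffun 'I_n.+1 -> config}.

Lemma hedge_glue t i b k :
  hedge (glue t) (i, b) k
  = if b then ((t.1 i).1 (inord k)).2 else ((t.1 i).1 (inord k)).1.
Proof. by rewrite /hedge ffunE. Qed.

Lemma vedge_glue_odd t (i : 'I_n) j : vedge (glue t) i.*2.+1 j = (t.1 i).2 j.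
Proof.
rewrite /vedge ffunE /= inordK /=; last by have := ltn_ord i; lia.
by rewrite odd_double /= uphalf_double valK.
Qed.

Lemma vedge_glue_even t k j : (k <= n)%N -> vedge (glue t) k.*2 j = t.2 (inord k) j.
Proof.
move=> lekn; rewrite /vedge ffunE /= inordK; last by lia.
by rewrite odd_double doubleK.
Qed.

Lemma state_wt_glue (z : 'I_n -> K) t :
  state_wt X z (glue t)
  = \prod_i strip_wt (z i) (t.1 i) (t.2 (inord i)) (t.2 (inord i.+1)).
Proof.
apply: eq_bigr => i _; rewrite /strip_wt /row_wt !hedge_glue; congr (_ * _ * _).
  apply: eq_bigr => j _; rewrite !hedge_glue /rows_above /= addn0.
  by rewrite vedge_glue_odd vedge_glue_even 1?ltnW.
apply: eq_bigr => j _; rewrite !hedge_glue /rows_above /= addn1.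
by rewrite vedge_glue_odd -doubleS vedge_glue_even.
Qed.

Variables (bd : boundary n m) (a : 'I_n -> color n) (z : 'I_n -> K).
Hypothesis left_Gamma : forall i, left_bd bd (i, false) = None.
Hypothesis left_Delta : forall i, left_bd bd (i, true) = Some (a i).

Lemma admissible_glue t :
  admissible bd (glue t) =
  [&& t.2 (inord n) == finfun (bottom_bd bd), t.2 (inord 0) == finfun (top_bd bd)
    & [forall i, (t.1 i).1 (inord m) == (None, Some (a i))]].
Proof.
have vE k (f : 'I_m -> spin n) : (k <= n)%N ->
    [forall j, vedge (glue t) k.*2 j == f j] = (t.2 (inord k) == finfun f).
  move=> lekn; apply/forallP/eqP => [E | E j].
    by apply/ffunP => j; rewrite ffunE -(eqP (E j)) vedge_glue_even.
  by rewrite vedge_glue_even // E ffunE.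
rewrite /admissible (vE n) // (vE 0%N) // andbC -andbA andbC -andbA.
congr (_ && _); rewrite andbC; congr (_ && _).
apply/forallP/forallP => [E i | E [i b]].
  have := E (i, false); have := E (i, true); rewrite !hedge_glue left_Gamma left_Delta.
  by case: (_ (inord m)) => p q /= /eqP-> /eqP->.
rewrite hedge_glue (eqP (E i)); case: b => /=; first by rewrite left_Delta.
by rewrite left_Gamma.
Qed.

(** Indexed by all natural numbers, as [transfer] requires. *)
Definition strips k beta tau : K :=
  if insub k is Some i then strip (z i) (a i) tau beta else 0.

Lemma partition_funE :
  partition_fun X z bd =
  transfer strips n (fun tau => (tau == finfun (top_bd bd))%:R) (finfun (bottom_bd bd)).
Proof.
rewrite /partition_fun (reindex glue) /=; last first.
  by exists unglue => t _; [exact: glueK | exact: unglueK].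
rewrite -sum_paths big_mkcond sum_pair exchange_big [RHS]big_mkcond /=.
apply: eq_bigr => e _; under eq_bigr do rewrite admissible_glue /=.
case: eqP => _ /=; last by rewrite big1.
case: eqP => _ /=; last by rewrite big1 // mul0r.
under [in RHS]eq_bigr do rewrite /strips valK -sum_strip_wt.
rewrite bigA_distr_bigA mul1r; apply: eq_bigr => ho _; rewrite state_wt_glue /=.
case: forallP => [E | /forallP]; first by apply: eq_bigr => i _; rewrite E mul1r.
by rewrite negb_forall => /existsP[i /negPf ni]; rewrite (bigD1 i) //= ni !mul0r.
Qed.

End StateSum.

(** * The last strip *)

Section OneStrip.

Variables (K : fieldType) (n m : nat) (X : cartan_type).
Notation config := {ffun 'I_m -> spin n}.
Implicit Types (tau beta : config) (z : K) (a c d : color n) (s v b : spin n).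

Lemma sum_Delta_bottom0 z s v (F : spin n -> K) :
  \sum_r Delta_wt z s v r None * F r
  = match s, v with
    | None, None => z * F None
    | Some c, None => 1 * F (Some c)
    | Some c, Some d => (d == c)%:R * F None
    | None, Some _ => 0
    end.
Proof.
case: s v => [c|] [d|].
- by apply: sum_supp1 => -[r|] /=; rewrite ?mul0r ?mul1r //; case: eqVneq.
- by apply: sum_supp1 => -[r|] /=; rewrite ?Some_eqE ?mulr1 ?mul0r // eq_sym; case: eqVneq.
- by rewrite sum_supp0 // => -[r|].
- by apply: sum_supp1 => -[r|] /=; rewrite ?mul0r ?mul1r.
Qed.

(** A color below the color of the incoming vertical path cannot turn. *)
Lemma sum_Delta_straight z c v b (F : spin n -> K) :
  (if v is Some d then color_lt c d else true) ->
  \sum_r Delta_wt z (Some c) v r b * F r = (v == b)%:R * F (Some c).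
Proof.
case: v => [d|] ltcd; last first.
  case: b => [b|].
    by rewrite sum_supp0 ?mul0r // => -[r|].
  by apply: sum_supp1 => -[r|] /=; rewrite ?mulr1 ?mul0r // Some_eqE eq_sym; case: eqVneq.
have ncd : (d == c) = false by rewrite color_rank_eq (gtn_eqF ltcd).
case: b => [b|]; last first.
  by rewrite sum_supp0 ?mul0r // => -[r|] //=; rewrite eq_sym ncd.
apply: sum_supp1 => -[r|] /=; last by rewrite mul0r.
rewrite ncd andbF andFb ltcd /= !Some_eqE [d == b]eq_sym.
by do 2!case: (_ == _); rewrite ?mulr0 ?mulr1.
Qed.

Local Arguments Gamma_wt : simpl never.
Local Arguments Delta_wt : simpl never.
Local Arguments Uturn_wt : simpl never.

Lemma transfer_stripS z tau beta j u s s' :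
  transfer (strip_column z tau beta) j.+1 u (s, s')
  = \sum_o Gamma_wt z s (fget None tau j) o.1 o.2 *
      \sum_r Delta_wt z^-1 s' o.2 r (fget None beta j) *
        transfer (strip_column z tau beta) j u (o.1, r).
Proof.
rewrite /= /mxop !sum_pair; apply: eq_bigr => p _.
under [RHS]eq_bigr do rewrite mulr_sumr.
rewrite [RHS]exchange_big; apply: eq_bigr => r _ /=.
by rewrite mulr_suml; apply: eq_bigr => v _; rewrite mulrA.
Qed.

(** The weight of the paths that enter a strip from column [j] and drop from
    the Gamma row to the Delta row before the U-turn, summed over the columns in
    which they can drop.  Here [kappa] is the weight of the empty U-turn. *)
Fixpoint drop_sum (kappa z : K) j : K :=
  if j is k.+1 then z * drop_sum kappa z k + kappa * (z * z ^- k) else 0.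

Definition Uturn00 z : K := @Uturn_wt K n X z None None.

Section EmptyBottom.

Variables (z : K) (tau : config).
Hypothesis nz_z : z != 0.
Let f j := transfer (strip_column z tau [ffun=> None]) j
             (fun q => Uturn_wt X z q.1 q.2).
Let empty j := all (fun k => fget None tau k == None) (iota 0 j).

Let fget0 k : fget None ([ffun=> None] : config) k = None.
Proof. by rewrite /fget; case: insub => //= i; rewrite ffunE. Qed.

Let emptyS j : empty j.+1 = empty j && (fget None tau j == None).
Proof. by rewrite /empty -addn1 iotaD all_cat /= andbT. Qed.

(** A path that arrives on the Gamma row has to leave on the Delta row. *)
Lemma last_strip_color_0 j d : f j (Some d, None) = 0.
Proof.
rewrite /f; elim: j d => [|j IHj] d //; rewrite transfer_stripS sum_Gamma fget0.
case: (fget None tau j) => [e|]; rewrite /= !sum_Delta_bottom0 ?IHj; last by rewrite !mulr0 addr0.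
by case: ifP => _; rewrite ?mulr0 ?addr0 //; case: ifP => _; rewrite ?mulr0.
Qed.

Lemma last_strip_0_0 j : f j (None, None) = (empty j)%:R * (Uturn00 z * z ^- j).
Proof.
elim: j => [|j IHj]; first by rewrite mul1r expr0 invr1 mulr1.
rewrite /f transfer_stripS sum_Gamma fget0 emptyS.
case: (fget None tau j) => [e|] /=; rewrite sum_Delta_bottom0.
  by rewrite -/(f j _) last_strip_color_0 andbF mul0r !mulr0.
by rewrite -/(f j _) IHj andbT exprS invfM; ring.
Qed.

Lemma last_strip_color_color j c a :
  f j (Some c, Some a)
  = (empty j)%:R * (z ^+ j * Uturn_wt X z (Some c) (Some a)
                    + (c == a)%:R * drop_sum (Uturn00 z) z j).
Proof.
elim: j c a => [|j IHj] c a; first by rewrite /f mul1r expr0 mul1r mulr0 addr0.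
rewrite /f transfer_stripS sum_Gamma fget0 emptyS.
case: (fget None tau j) => [e|]; rewrite !sum_Delta_bottom0 -!/(f j _).
  rewrite /= !last_strip_color_0 andbF mul0r !mulr0 addr0.
  by case: ifP => _ //; case: ifP => _.
by rewrite /= IHj last_strip_0_0 andbT exprS; ring.
Qed.

Lemma last_strip_0_color j a :
  f j.+1 (None, Some a)
  = if fget None tau j is Some d then f j (Some d, Some a) else f j (None, Some a).
Proof.
rewrite /f transfer_stripS sum_Gamma fget0.
by case: (fget None tau j) => [e|]; rewrite sum_Delta_bottom0 !mul1r.
Qed.

End EmptyBottom.

Definition last_root_factor z : K := match X with TypeB => z^-1 | TypeC => z ^- 2 end.

Lemma drop_sumE z j : z != 0 ->
  (1 - last_root_factor z) * drop_sum (Uturn00 z) z j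
  = last_root_factor z * (z ^+ j - z ^- j).
Proof.
move=> nz_z; elim: j => [|j IHj] /=; first by rewrite expr0 invr1 subrr !mulr0.
have nz_zj : z ^+ j != 0 by rewrite expf_neq0.
rewrite mulrDr mulrCA IHj /Uturn00 /Uturn_wt /last_root_factor (exprS z j); case: X => /=;
  by field; rewrite nz_z nz_zj.
Qed.

Lemma last_root_factorV z : z != 0 -> last_root_factor z^-1 = (last_root_factor z)^-1.
Proof. by move=> nz_z; rewrite /last_root_factor; case: X; rewrite ?exprVn. Qed.

(** The paths that drop contribute to the outgoing barred color a term that is
    annihilated by the Demazure operator. *)
Lemma drop_sumV z j : z != 0 -> 1 - last_root_factor z != 0 ->
  drop_sum (Uturn00 z) z j = last_root_factor z * drop_sum (Uturn00 z^-1) z^-1 j.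
Proof.
move=> nz_z nz_r; apply: (mulfI nz_r); rewrite drop_sumE //.
have nz_r' : last_root_factor z != 0.
  by rewrite /last_root_factor; case: X; rewrite invr_eq0 ?expf_neq0.
have := @drop_sumE z^-1 j; rewrite invr_eq0 last_root_factorV // => /(_ nz_z).
set D := drop_sum _ _ j; set r := last_root_factor z in nz_r nz_r' * => E.
have -> : (1 - r) * (r * D) = - r ^+ 2 * ((1 - r^-1) * D) by field.
by rewrite E !exprVn invrK; field; rewrite nz_r' expf_neq0.
Qed.

(** All weights to the left of the leftmost path are 1, so the identity may be
    checked in the column where this path enters, by the closed form of
    [last_strip_color_color]. *)
Lemma last_strip z tau (i : 'I_n) : z != 0 -> 1 - last_root_factor z != 0 ->
  (1 - last_root_factor z) * strip X z (i, false) tau [ffun=> None]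
  = strip X z (i, true) tau [ffun=> None]
    - last_root_factor z * strip X z^-1 (i, true) tau [ffun=> None].
Proof.
move=> nz_z nz_r; have nz_zV : z^-1 != 0 by rewrite invr_eq0.
pose f (y : K) j := transfer (strip_column y tau [ffun=> None]) j (fun q => Uturn_wt X y q.1 q.2).
suff E j : (1 - last_root_factor z) * f z j (None, Some (i, false))
    = f z j (None, Some (i, true)) - last_root_factor z * f z^-1 j (None, Some (i, true)).
  exact: E.
elim: j => [|j IHj]; first by rewrite /f /= /Uturn_wt !mulr0 subr0.
rewrite /f !last_strip_0_color; case: (fget None tau j) => [d|]; last exact: IHj.
rewrite !last_strip_color_color // /Uturn_wt.
have E := drop_sumE j nz_z; have EV := drop_sumV j nz_z nz_r.
have [->|ndf] := eqVneq d (i, false).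
  rewrite /sbar /= !xpair_eqE !eqxx /= exprVn.
  rewrite !mul0r !addr0 !mulr1 mul1r mulrCA mulrDr E.
  by ring.
have [->|ndt] := eqVneq d (i, true).
  by rewrite /= !mulr0 !add0r !mul0r !mulr0 EV; ring.
case: d ndf {ndt} => k [] ndf /=; first by rewrite !(mulr0, mul0r, addr0) subrr.
have nik : (i == k) = false by apply: contraNF ndf => /eqP->.
by rewrite /sbar !xpair_eqE nik !(mulr0, mul0r, addr0) subrr.
Qed.

(** * The ground state *)

(** The outgoing barred color can only come from the U-turn, where it arrives
    as the color [(i, false)].  So this path runs through the whole strip and
    crosses all the others, which therefore go straight down: there is only one
    state. *)
Lemma rigid_strip z (i : 'I_n) tau beta (p : 'I_m) :
  tau p = Some (i, false) ->
  (forall k : 'I_m, (p < k)%N -> tau k = None) ->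
  (forall (k : 'I_m) d, (k < p)%N -> tau k = Some d ->
     color_lt (i, true) d && color_lt d (i, false)) ->
  strip X z (i, true) tau beta
  = z ^+ p * (beta == [ffun k => if k == p then None else tau k])%:R.
Proof.
move=> tau_p tau_gt tau_lt.
pose f j := transfer (strip_column z tau beta) j (fun q => Uturn_wt X z q.1 q.2).
have lt_if : color_lt (i, true) (i, false).
  by rewrite /color_lt rank_lt.
have tauN k : (p < k)%N -> fget None tau k = None.
  rewrite /fget; case: insubP => //= k' _ <-; exact: tau_gt.
have tauP k d : (k < p)%N -> fget None tau k = Some d ->
    color_lt (i, true) d && color_lt d (i, false).
  by rewrite /fget; case: insubP => //= k' _ <-; exact: tau_lt.
(* To the right of column [p], the color [(i, false)] can be on the Gamma row
   only; if it is not there, it cannot reach the U-turn. *)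
have f0 j s : (j <= p)%N -> s != Some (i, false) ->
    (if s is Some d then color_lt (i, true) d else true) ->
    f j (s, Some (i, true)) = 0.
  elim: j s => [|j IHj] s ltjp ns lts.
    rewrite /f /=; case: s ns lts => [[k [|]]|] //= nki _.
    have nik : (i == k) = false by apply: contraNF nki => /eqP->.
    by rewrite /Uturn_wt /sbar !xpair_eqE nik.
  rewrite /f transfer_stripS sum_Gamma.
  have ih r : r != Some (i, false) -> (if r is Some d then color_lt (i, true) d else true) ->
    transfer (strip_column z tau beta) j (fun q => Uturn_wt X z q.1 q.2)
      (r, Some (i, true)) = 0 by exact: IHj (ltnW ltjp).
  case Et: (fget None tau j) => [e|].
    have /andP[lte lte'] := tauP _ _ ltjp Et.
    have ne : Some e != Some (i, false) :> spin n.
      by rewrite Some_eqE color_rank_eq (ltn_eqF lte').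
    case: s ns lts => [d|] ns lts; rewrite !sum_Delta_straight ?ih ?mulr0 ?addr0 //=.
    by case: ifP => _ //; case: ifP.
  case: s ns lts => [d|] ns lts; rewrite !sum_Delta_straight ?ih ?mulr0 ?addr0 //=.
(* The conclusion in the first [j] columns. *)
pose good j := all (fun k : nat => (if k == p :> nat then None else fget None tau k) == fget None beta k) (iota 0 j).
have goodS j : good j.+1
    = good j && ((if j == p :> nat then None else fget None tau j) == fget None beta j).
  by rewrite /good -addn1 iotaD all_cat /= andbT.
have f1 j : (j <= p)%N -> f j (Some (i, false), Some (i, true)) = z ^+ j * (good j)%:R.
  elim: j => [|j IHj] ltjp.
    by rewrite /f /= /Uturn_wt /sbar !eqxx mulr1.
  have := IHj (ltnW ltjp); rewrite goodS (ltn_eqF ltjp) /f => IH.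
  rewrite transfer_stripS sum_Gamma exprS.
  have ih r : r != Some (i, false) -> (if r is Some d then color_lt (i, true) d else true) ->
    transfer (strip_column z tau beta) j (fun q => Uturn_wt X z q.1 q.2)
      (r, Some (i, true)) = 0 by exact: f0 (ltnW ltjp).
  case Et: (fget None tau j) => [e|] /=.
    have /andP[lte lte'] := tauP _ _ ltjp Et.
    have ne : Some e != Some (i, false) :> spin n.
      by rewrite Some_eqE color_rank_eq (ltn_eqF lte').
    rewrite -/(color_lt e (i, false)) lte' !sum_Delta_straight // (ih (Some e)) //= IH.
    by rewrite -mulnb natrM; ring.
  by rewrite !sum_Delta_straight // (ih None) //= IH -mulnb natrM; ring.
have f2 j : (p < j)%N -> f j (None, Some (i, true)) = z ^+ p * (good j)%:R.
  elim: j => [|j IHj] //; rewrite ltnS leq_eqVlt => /orP[/eqP<-|ltpj].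
    have := f1 _ (leqnn p); rewrite /f => f1p.
    rewrite transfer_stripS sum_Gamma fget_ord tau_p sum_Delta_straight //= f1p.
    by rewrite goodS eqxx -mulnb natrM; ring.
  have := IHj ltpj; rewrite /f => IH.
  rewrite transfer_stripS sum_Gamma tauN // sum_Delta_straight //= IH.
  by rewrite goodS (gtn_eqF ltpj) tauN // -mulnb natrM; ring.
rewrite [LHS]f2 //; congr (_ * (nat_of_bool _)%:R).
apply/idP/eqP => [/allP E | eqb]; last (rewrite /good eqb; apply/allP => k).
  apply/ffunP => k; have := E k; rewrite mem_iota ltn_ord => /(_ isT) /eqP.
  by rewrite !fget_ord ffunE => <-.
rewrite mem_iota => /andP[_ ltkm].
by rewrite (fget_ord None tau (Ordinal ltkm)) (fget_ord None _ (Ordinal ltkm)) ffunE.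
Qed.

End OneStrip.

(** * Reduced words *)

Section Words.

Variable n : nat.
Implicit Types (i j : 'I_n) (x y p : signed n) (ss : seq 'I_n).

Lemma next_ordP i :
  (exists2 j : 'I_n, next_ord i = Some j & j = i.+1 :> nat)
  \/ next_ord i = None /\ i.+1 = n.
Proof.
rewrite /next_ord; case: insubP => [j _ ej | nlt]; first by left; exists j.
by right; split=> //; have := ltn_ord i; lia.
Qed.

Lemma srefl_last i x : next_ord i = None ->
  srefl i x = if x.1 == i then sbar x else x.
Proof. by rewrite /srefl => ->. Qed.

Lemma srefl_next i j x : next_ord i = Some j -> srefl i x = (tperm i j x.1, x.2).
Proof. by rewrite /srefl => ->. Qed.

Lemma srefl_sbar i x : srefl i (sbar x) = sbar (srefl i x).
Proof. by rewrite /srefl; case: next_ord => [j|] //=; case: ifP. Qed.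

Lemma sreflK i : involutive (srefl i).
Proof.
move=> [k b]; rewrite /srefl; case: next_ord => [j|] /=; first by rewrite tpermK.
by have [->|nki] := eqVneq k i; rewrite /sbar /= ?eqxx ?negbK // (negPf nki).
Qed.

Lemma word_fun_cat ss1 ss2 x :
  word_fun (ss1 ++ ss2) x = word_fun ss1 (word_fun ss2 x).
Proof. by elim: ss1 => //= i ss1 ->. Qed.

Lemma word_fun_rcons ss i x : word_fun (rcons ss i) x = word_fun ss (srefl i x).
Proof. by rewrite -cats1 word_fun_cat. Qed.

Lemma word_fun_sbar ss x : word_fun ss (sbar x) = sbar (word_fun ss x).
Proof. by elim: ss => //= i ss ->; rewrite srefl_sbar. Qed.

Lemma word_funK ss : cancel (word_fun ss) (word_fun (rev ss)).
Proof.
elim: ss => [|i ss IHss] x //=.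
by rewrite rev_cons word_fun_rcons /= sreflK IHss.
Qed.

Lemma word_fun_revK ss : cancel (word_fun (rev ss)) (word_fun ss).
Proof. by move=> x; rewrite -{1}[ss]revK word_funK. Qed.

Lemma srefl_moves i : srefl i (i, false) != (i, false).
Proof.
case: (next_ordP i) => [[j ij ej]|[iN _]].
  rewrite (srefl_next _ ij) tpermL xpair_eqE /= andbT -val_eqE /= ej.
  by rewrite eqn_leq ltnn.
by rewrite srefl_last //= eqxx /sbar xpair_eqE andbF.
Qed.

Lemma srefl_moved i p x : srefl i p != p -> srefl i x != x ->
  x \in [:: p; srefl i p; sbar p; sbar (srefl i p)].
Proof.
have [[j ij ej]|[iN _]] := next_ordP i.
  case: p x => [k b] [l c]; rewrite !(srefl_next _ ij) /= !xpair_eqE !eqxx !andbT.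
  case: tpermP => [->|->|_ _] //=; last by rewrite eqxx.
    case: tpermP => [->|->|_ _] //=; last by rewrite eqxx.
      by move=> _ _; rewrite !inE /sbar /= !xpair_eqE !eqxx /=; case: b; case: c; rewrite ?orbT.
    by move=> _ _; rewrite !inE /sbar /= !xpair_eqE !eqxx /=; case: b; case: c; rewrite ?orbT.
  case: tpermP => [->|->|_ _] //=; last by rewrite eqxx.
    by move=> _ _; rewrite !inE /sbar /= !xpair_eqE !eqxx /=; case: b; case: c; rewrite ?orbT.
  by move=> _ _; rewrite !inE /sbar /= !xpair_eqE !eqxx /=; case: b; case: c; rewrite ?orbT.
case: p x => [k b] [l c]; rewrite !srefl_last //=.
have [->|_] := eqVneq k i; last by rewrite eqxx.
have [->|_] := eqVneq l i; last by rewrite eqxx.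
by move=> _ _; rewrite !inE /sbar /= !xpair_eqE !eqxx /=; case: b; case: c.
Qed.

(** Since the letters exchanged by a simple reflection are adjacent, no other
    pair changes its order. *)
Lemma srefl_flip i x y : color_lt y x -> ~~ color_lt (srefl i y) (srefl i x) ->
  y = srefl i x.
Proof.
have [[j ij ej]|[iN ei]] := next_ordP i; case: x y => [k b] [l c].
  rewrite !(srefl_next _ ij) /= /color_lt.
  have neq k' l' : (k' : 'I_n) <> l' -> k' <> l' :> nat by move=> ne /val_inj.
  case: tpermP => [->|->|/neq nli /neq nlj]; case: tpermP => [->|->|/neq nki /neq nkj];
    rewrite !rank_lt; case: b; case: c => //=; rewrite ?ltnn //;
    by move=> *; exfalso; lia.
have ltin q : (q : 'I_n) <> i -> (q < i)%N.
  by move/eqP; rewrite -val_eqE /=; have := ltn_ord q; lia.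
rewrite !srefl_last //=; case: (eqVneq l i) => [->|/eqP/ltin ltli];
  case: (eqVneq k i) => [->|/eqP/ltin ltki]; rewrite /color_lt !rank_lt /sbar;
  case: b; case: c => //=; rewrite ?ltnn //; by move=> *; exfalso; lia.
Qed.

(** The simple root of [i] is encoded by the pair of the letters [(i, false)] and
    [srefl i (i, false)], and its image under the inverse of the product of
    [ss] is positive if this inverse preserves their order. *)
Definition negative_root ss i :=
  ~~ color_lt (word_fun (rev ss) (srefl i (i, false))) (word_fun (rev ss) (i, false)).

(** The exchange condition: the inverses of the first prefixes of the word send
    the simple root of [i] to positive roots.  The letter [j] at which the sign
    changes acts by a simple reflection that exchanges the two letters of the
    root, so conjugating [j] by the preceding prefix gives [i], and a letter
    [i] on the left cancels [j]. *)
Lemma exchange_word ss i : negative_root ss i ->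
  exists ss', (size ss' < size ss)%N /\ word_fun ss' =1 srefl i \o word_fun ss.
Proof.
elim/last_ind: ss => [|ss j IHss].
  rewrite /negative_root /=; have [[j ij ej]|[iN _]] := next_ordP i.
    by rewrite (srefl_next _ ij) /= tpermL /color_lt rank_lt /= ej ltnSn.
  by rewrite srefl_last //= eqxx /sbar /color_lt rank_lt.
rewrite {1}/negative_root rev_rcons /=; case neg: (negative_root ss i).
  have [ss' [ltss' Ess']] := IHss neg; exists (rcons ss' j).
  by rewrite !size_rcons; split=> // x; rewrite /= !word_fun_rcons Ess'.
move/negbFE: neg => lt_ss /(srefl_flip lt_ss).
set p := word_fun (rev ss) (i, false); set q := word_fun (rev ss) _ => qE.
exists ss; rewrite size_rcons; split=> // x; rewrite /= word_fun_rcons.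
have fp : word_fun ss p = (i, false) by rewrite word_fun_revK.
have fq : word_fun ss q = srefl i (i, false) by rewrite word_fun_revK.
have npq : srefl j p != p.
  by rewrite -qE; apply: contraNneq (srefl_moves i) => eqp; rewrite -fq eqp fp.
case: (boolP (x \in [:: p; q; sbar p; sbar q])) => [|nx].
  rewrite !inE => /or4P[] /eqP->; rewrite ?srefl_sbar ?word_fun_sbar ?srefl_sbar.
  - by rewrite -qE fq sreflK.
  - by rewrite qE sreflK fp -qE fq.
  - by rewrite -qE fq sreflK fp.
  - by rewrite qE sreflK fp -qE fq.
have -> : srefl j x = x.
  by apply/eqP; apply: contraNT nx => /(srefl_moved npq); rewrite -qE.
apply/esym/eqP; apply: contraNT nx => /(srefl_moved (srefl_moves i)).
rewrite !inE /p /q -!word_fun_sbar.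
by case/or4P=> /eqP <-; rewrite word_funK eqxx ?orbT.
Qed.

Lemma reduced_cons_positive ss i (w : {perm signed n}) :
  reduced_word w (i :: ss) -> ~~ negative_root ss i.
Proof.
case=> wE wmin; apply/negP => /exchange_word[ss' [ltss' Ess']].
have := wmin ss' (fun x => etrans (wE x) (esym (Ess' x))).
by rewrite /= leqNgt (leq_trans ltss').
Qed.

Lemma reduced_cons ss i (w : {perm signed n}) :
  reduced_word w (i :: ss) -> exists w' : {perm signed n}, reduced_word w' ss.
Proof.
case=> wE wmin; exists (perm (can_inj (word_funK ss))); split=> [x|ss' E].
  by rewrite permE.
have /= := wmin (i :: ss'); apply => x; rewrite wE /=.
by rewrite -E permE.
Qed.

Lemma word_inv ss (w : {perm signed n}) : w =1 word_fun ss ->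
  (w^-1)%g =1 word_fun (rev ss).
Proof. by move=> wE x; apply: (@perm_inj _ w); rewrite permKV wE word_fun_revK. Qed.

End Words.

(** * Substitution in rational functions *)

Lemma subf_div (F : fieldType) (a b c d : F) : b != 0 -> d != 0 ->
  a / b - c / d = (a * d - c * b) / (b * d).
Proof. by move=> nb nd; field; rewrite nb nd. Qed.

Lemma fracE (A : idomainType) (f : {fraction A}) :
  tofrac \n_(generic_quotient.repr f) / tofrac \d_(generic_quotient.repr f) = f.
Proof.
have nd : \d_(generic_quotient.repr f) != 0 by [].
apply: (canLR (mulfK _)); first by rewrite tofrac_eq0.
have := generic_quotient.reprK f; move: (generic_quotient.repr f) nd => r nd <-.
unlock FracField.tofrac.
rewrite -[RHS]FracField.pi_mul; apply/generic_quotient.eqmodP.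
rewrite /= FracField.equivfE /FracField.mulf.
by rewrite !(numden_Ratio, mulr1, mul1r) ?oner_eq0 // mulrC.
Qed.

Lemma mpolyX_inj (R : idomainType) n : injective (fun m => 'X_[m] : {mpoly R[n]}).
Proof.
move=> m m' /(congr1 (mcoeff m)) /eqP; rewrite !mcoeffX eqxx.
by have [-> //|_] := eqVneq m' m; rewrite oner_eq0.
Qed.

Lemma mpolyX_neq0 (R : idomainType) n m : 'X_[m] != 0 :> {mpoly R[n]}.
Proof.
apply/eqP => /(congr1 (mcoeff m)) /eqP.
by rewrite mcoeffX eqxx mcoeff0 oner_eq0.
Qed.

Lemma zvar_neq0 (R : idomainType) n (i : 'I_n) : zvar R i != 0.
Proof. by rewrite tofrac_eq0 mpolyX_neq0. Qed.

Section Substitution.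

Variables (R : idomainType) (n : nat) (i : 'I_n).
Notation K := (ratfun R n).
Notation v := (act_vars i (@zvar R n)).

(** This is [mpoly_at], written with a composition of morphisms so that it is
    itself recognized as a morphism. *)
Definition mpoly_subst : {mpoly R[n]} -> K :=
  mmap (@tofrac {mpoly R[n]} \o @mpolyC n R) v.
HB.instance Definition _ := GRing.RMorphism.on mpoly_subst.

Lemma mpoly_substX k : mpoly_subst 'X_k = v k.
Proof. by rewrite /mpoly_subst mmapX mmap1U. Qed.

Lemma mpoly_substC c : mpoly_subst c%:MP = tofrac (c%:MP_[n]).
Proof. by rewrite /mpoly_subst mmapC. Qed.

(** The denominator that the substitution can produce. *)
Definition inverted_mpoly : {mpoly R[n]} := if next_ord i is Some _ then 1 else 'X_i.

Lemma mpoly_subst_inverted : mpoly_subst inverted_mpoly * tofrac inverted_mpoly = 1.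
Proof.
rewrite /inverted_mpoly; have [[j ij _]|[iN _]] := next_ordP i.
  by rewrite ij !rmorph1 mulr1.
by rewrite iN mpoly_substX /act_vars iN eqxx mulVf // zvar_neq0.
Qed.

(** The substitution is an involution of Laurent polynomials.  Stated for
    polynomials, with a common power of the denominator cleared on both sides,
    this is a property that is stable under sums and products; it implies that
    the substitution is injective. *)
Lemma mpoly_subst_invol p : exists N q,
  mpoly_subst p * tofrac inverted_mpoly ^+ N = tofrac q
  /\ mpoly_subst q * tofrac inverted_mpoly ^+ N = tofrac p.
Proof.
set u := inverted_mpoly; pose invol p := exists N q,
  mpoly_subst p * tofrac u ^+ N = tofrac q /\ mpoly_subst q * tofrac u ^+ N = tofrac p.
have uE M : mpoly_subst (u ^+ M) * tofrac u ^+ M = 1.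
  by rewrite rmorphXn -exprMn mpoly_subst_inverted expr1n.
have involC c : invol c%:MP.
  by exists 0%N, c%:MP; rewrite expr0 !mulr1 mpoly_substC.
have involM p1 p2 : invol p1 -> invol p2 -> invol (p1 * p2).
  move=> [N1 [q1 [E1 F1]]] [N2 [q2 [E2 F2]]]; exists (N1 + N2)%N, (q1 * q2).
  by rewrite !rmorphM /= exprD -E1 -E2 -F1 -F2; split; ring.
have involD p1 p2 : invol p1 -> invol p2 -> invol (p1 + p2).
  move=> [N1 [q1 [E1 F1]]] [N2 [q2 [E2 F2]]].
  exists (N1 + N2)%N, (q1 * u ^+ N2 + q2 * u ^+ N1).
  rewrite !rmorphD !rmorphM /= exprD !rmorphXn /= -E1 -E2 -F1 -F2; split; first by ring.
  have := uE N1; have := uE N2; rewrite !rmorphXn /= => U2 U1.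
  rewrite mulrDl mulrACA U2 mulr1; congr (_ + _).
  by rewrite [_ ^+ N1 * _]mulrC mulrACA U1 mulr1.
have involX k : invol 'X_k.
  have [[j ij _]|[iN _]] := next_ordP i.
    exists 0%N, 'X_(tperm i j k).
    by rewrite expr0 !mulr1 !mpoly_substX /act_vars ij tpermK.
  have [->|nki] := eqVneq k i.
    exists 1%N, 1; rewrite !expr1 !rmorph1 mul1r -mpoly_subst_inverted.
    by rewrite /u /inverted_mpoly iN.
  exists 0%N, 'X_k.
  by rewrite expr0 !mulr1 !mpoly_substX /act_vars iN (negPf nki).
elim/mpolyind: p => [|c m p _ _ IHp]; first by rewrite -(mpolyC0 n R); exact: involC.
apply: (involD) => //; rewrite -mul_mpolyC; apply: (involM) => //.
rewrite mpolyXE_id; apply: (big_ind invol) => [||k _].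
- by rewrite -mpolyC1; exact: involC.
- exact: involM.
elim: (m k) => [|e IHe]; first by rewrite expr0 -mpolyC1; exact: involC.
by rewrite exprS; apply: (involM).
Qed.

Lemma mpoly_subst_inj p : mpoly_subst p = 0 -> p = 0.
Proof.
have [N [q [pE qE]]] := mpoly_subst_invol p; move=> p0.
move: pE; rewrite p0 mul0r => /esym/eqP; rewrite tofrac_eq0 => /eqP q0.
by apply/eqP; rewrite -tofrac_eq0 -qE q0 rmorph0 mul0r.
Qed.

Definition weyl_subst (f : K) : K := ratfun_at f v.

Lemma weyl_subst_frac p q : q != 0 ->
  weyl_subst (tofrac p / tofrac q) = mpoly_subst p / mpoly_subst q.
Proof.
move=> nq; set f := _ / _; have := fracE f; rewrite {3}/f.
change (weyl_subst f) with (mpoly_subst \n_(generic_quotient.repr f)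
                            / mpoly_subst \d_(generic_quotient.repr f)).
move: (generic_quotient.repr f) (denom_ratioP (generic_quotient.repr f)) => r nd.
have nz s : s != 0 -> mpoly_subst s != 0.
  by apply: contraNneq => /mpoly_subst_inj ->.
move/eqP; rewrite eqr_div ?tofrac_eq0 // -!tofracM tofrac_eq => /eqP E.
by apply/eqP; rewrite eqr_div ?nz // -!rmorphM E.
Qed.

Lemma weyl_subst_tofrac p : weyl_subst (tofrac p) = mpoly_subst p.
Proof.
by rewrite -[tofrac p]divr1 -tofrac1 weyl_subst_frac ?oner_eq0 // rmorph1 divr1.
Qed.

Lemma weyl_subst_zvar k : weyl_subst (zvar R k) = v k.
Proof. by rewrite weyl_subst_tofrac mpoly_substX. Qed.

Lemma weyl_subst_is_zmod_morphism : zmod_morphism weyl_subst.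
Proof.
move=> f g; rewrite -(fracE f) -(fracE g).
set a := \n_ _; set b := \d_ _; set c := \n_ _; set d := \d_ _.
have [nb nd] : b != 0 /\ d != 0 by split; apply: denom_ratioP.
have nz s : s != 0 -> mpoly_subst s != 0.
  by apply: contraNneq => /mpoly_subst_inj ->.
rewrite subf_div ?tofrac_eq0 // -!tofracM -tofracB.
rewrite !weyl_subst_frac ?mulf_neq0 // rmorphB !rmorphM /=.
by rewrite subf_div ?nz.
Qed.

Lemma weyl_subst_is_monoid_morphism : monoid_morphism weyl_subst.
Proof.
split=> [|f g]; first by rewrite -tofrac1 weyl_subst_tofrac rmorph1.
rewrite -(fracE f) -(fracE g).
set a := \n_ _; set b := \d_ _; set c := \n_ _; set d := \d_ _.
have [nb nd] : b != 0 /\ d != 0 by split; apply: denom_ratioP.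
by rewrite mulf_div -!tofracM !weyl_subst_frac ?mulf_neq0 // !rmorphM mulf_div.
Qed.

HB.instance Definition _ :=
  GRing.isZmodMorphism.Build K K weyl_subst weyl_subst_is_zmod_morphism.
HB.instance Definition _ :=
  GRing.isMonoidMorphism.Build K K weyl_subst weyl_subst_is_monoid_morphism.

End Substitution.

(** * Demazure recursion *)

Section Recursion.

Variables (K : fieldType) (n m : nat) (X : cartan_type).
Notation config := {ffun 'I_m -> spin n}.
Implicit Types (a : 'I_n -> color n) (z : 'I_n -> K) (tau beta : config).

Lemma transfer_add (S : finType) (W : nat -> S -> S -> K) N p v s : (p <= N)%N ->
  transfer W N v s = transfer (fun k => W (k + p)%N) (N - p) (transfer W p v) s.
Proof.
move=> lepN; rewrite -{1}(subnK lepN); elim: (N - p)%N s => [|q IHq] s //=.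
by apply: eq_bigr => r _; rewrite IHq.
Qed.

Lemma transfer_linear (S : finType) (W : nat -> S -> S -> K) q (c d : K) u v s :
  transfer W q (fun s => c * u s + d * v s) s
  = c * transfer W q u s + d * transfer W q v s.
Proof.
elim: q s => [|q IHq] s //=; rewrite /mxop !mulr_sumr -big_split /=.
by apply: eq_bigr => r _; rewrite IHq; ring.
Qed.

Lemma sum_enum_val (T : finType) (F : T -> K) : \sum_t F t = \sum_(i < #|T|) F (enum_val i).
Proof. by rewrite -(big_enum_val F). Qed.

Lemma two_strips (x y : K) (c d : color n) beta v :
  \sum_tau strip X y d tau beta * (\sum_tau' strip X x c tau' tau * v tau')
  = \sum_i (strip_transfer m X x c *m strip_transfer m X y d) i (enum_rank beta)
           * v (enum_val i).
Proof.
rewrite sum_enum_val.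
transitivity (\sum_(k < #|{: config}|) \sum_(i < #|{: config}|)
    strip_transfer m X x c i k * strip_transfer m X y d k (enum_rank beta)
    * v (enum_val i)).
  apply: eq_bigr => k _; rewrite sum_enum_val mulr_sumr; apply: eq_bigr => i _.
  by rewrite !strip_transferE enum_rankK; ring.
rewrite exchange_big; apply: eq_bigr => i _ /=.
by rewrite mxE mulr_suml.
Qed.

(** [strip_exchange] inside the whole lattice: the strips above and below are
    the same in the three terms. *)
Lemma exchange_adjacent a z (i j : 'I_n) (v : config -> K) beta : next_ord i = Some j ->
  color_lt (a i) (a j) -> z i != 0 -> z j != 0 ->
  (z i - z j) * transfer (strips X (a \o tperm i j) z) n v beta
  = z i * (transfer (strips X a z) n v beta
           - transfer (strips X a (z \o tperm i j)) n v beta).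
Proof.
move=> ij lta nzi nzj.
have ej : j = i.+1 :> nat.
  have [[j' ij' ej']|[iN _]] := next_ordP i; last by rewrite iN in ij.
  by move: ij'; rewrite ij => -[->].
have lein : (i.+2 <= n)%N by have := ltn_ord j; rewrite ej.
rewrite !(transfer_add _ _ _ lein).
set a' := a \o _; set z' := z \o _.
have outer b y : b = a \/ b = a' -> y = z \/ y = z' -> forall v, 
    transfer (fun k => strips X b y (k + i.+2)) (n - i.+2) v beta
    = transfer (fun k => strips X a z (k + i.+2)) (n - i.+2) v beta.
  move=> eb ey u; apply: eq_transfer => // k s r _; rewrite /strips.
  case: insubP => //= l _ el.
  have tl : tperm i j l = l by rewrite tpermD // -val_eqE /= ?ej el; lia.
  by case: eb ey => [->|->] [->|->]; rewrite /a' /z' /= ?tl.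
rewrite !outer; try by [left | right].
have inner b y : b = a \/ b = a' -> y = z \/ y = z' ->
    transfer (strips X b y) i v =1 transfer (strips X a z) i v.
  move=> eb ey; apply: eq_transfer => // k s r ltk; rewrite /strips.
  case: insubP => //= l _ el.
  have tl : tperm i j l = l by rewrite tpermD // -val_eqE /= ?ej el; lia.
  by case: eb ey => [->|->] [->|->]; rewrite /a' /z' /= ?tl.
have middle b y : b = a \/ b = a' -> y = z \/ y = z' ->
    transfer (strips X b y) i.+2 v =1 fun beta => \sum_k
      (strip_transfer m X (y i) (b i) *m strip_transfer m X (y j) (b j)) k (enum_rank beta)
      * transfer (strips X a z) i v (enum_val k).
  move=> eb ey s; rewrite -two_strips /= /mxop; apply: eq_bigr => r _.
  rewrite {1}/strips -ej valK; congr (_ * _); apply: eq_bigr => t _.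
  by rewrite {1}/strips valK inner.
have combine u u' u'' : (forall s, (z i - z j) * u s = z i * (u' s - u'' s)) ->
    (z i - z j) * transfer (fun k => strips X a z (k + i.+2)) (n - i.+2) u beta
    = z i * (transfer (fun k => strips X a z (k + i.+2)) (n - i.+2) u' beta
             - transfer (fun k => strips X a z (k + i.+2)) (n - i.+2) u'' beta).
  move=> E; set T := transfer _ _.
  have -> : (z i - z j) * T u beta = T (fun s => (z i - z j) * u s + 0 * u s) beta.
    by rewrite /T transfer_linear mul0r addr0.
  have -> : z i * (T u' beta - T u'' beta) = T (fun s => z i * u' s + - z i * u'' s) beta.
    by rewrite /T transfer_linear; ring.
  by apply: eq_transfer => // s; rewrite mul0r addr0 E; ring.
apply: combine => s; rewrite !middle; try by [left | right].
rewrite /a' /z' /= tpermL tpermR mulr_sumr -sumrB mulr_sumr.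
apply: eq_bigr => k _; rewrite mulrA -mulrBl mulrA; congr (_ * _).
have /matrixP/(_ k (enum_rank s)) := strip_exchange m X nzi nzj lta.
by rewrite !mxE => ->; ring.
Qed.

Lemma exchange_last a z (i : 'I_n) (v : config -> K) : next_ord i = None -> (a i).2 -> z i != 0 ->
  1 - last_root_factor X (z i) != 0 ->
  (1 - last_root_factor X (z i))
    * transfer (strips X (fun k => if k == i then sbar (a k) else a k) z) n v [ffun=> None]
  = transfer (strips X a z) n v [ffun=> None]
    - last_root_factor X (z i)
      * transfer (strips X a (fun k => if k == i then (z k)^-1 else z k)) n v [ffun=> None].
Proof.
move=> iN ai_barred nzi nzr.
have [[j ij _]|[_ ei]] := next_ordP i; first by rewrite iN in ij.
have lein : (i <= n)%N by rewrite ltnW.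
rewrite !(transfer_add _ _ _ lein).
have -> : (n - i)%N = 1%N by rewrite -{1}ei subSnn.
set a' := fun k => if k == i then sbar (a k) else a k.
set z' := fun k => if k == i then (z k)^-1 else z k.
have inner b y : b = a \/ b = a' -> y = z \/ y = z' ->
    transfer (strips X b y) i v =1 transfer (strips X a z) i v.
  move=> eb ey; apply: eq_transfer => // k s r ltk; rewrite /strips.
  case: insubP => //= l _ el.
  have nli : (l == i) = false by rewrite -val_eqE /= el ltn_eqF.
  by case: eb ey => [->|->] [->|->]; rewrite /a' /z' /= ?nli.
rewrite /= /mxop !mulr_sumr -sumrB; apply: eq_bigr => tau _.
rewrite !inner; try by [left | right].
rewrite add0n /strips valK /a' /z' eqxx.
case: (a i) ai_barred => k [] //= _; rewrite /sbar /=.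
by rewrite mulrA last_strip //; ring.
Qed.

(** The configuration above the strip [k] in the only state for the identity. *)
Definition ground (lam : 'I_n -> nat) k : config :=
  [ffun p : 'I_m => omap (fun i => (i, false))
     [pick i : 'I_n | (k <= i)%N && (p == (lam i + n - i.+1)%N :> nat)]].

Lemma ground_state (lam : 'I_n -> nat) z :
  (forall i j : 'I_n, (i <= j)%N -> (lam j <= lam i)%N) ->
  (forall i, (lam i + n - i.+1 < m)%N) ->
  transfer (strips X (fun i => (i, true)) z) n
    (fun tau => (tau == ground lam 0)%:R) [ffun=> None]
  = \prod_i z i ^+ (lam i + n - i.+1).
Proof.
move=> lam_dec lam_lt; pose pos (i : 'I_n) := (lam i + n - i.+1)%N.
have pos_dec (i j : 'I_n) : (i < j)%N -> (pos j < pos i)%N.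
  by move=> ltij; have := lam_dec i j (ltnW ltij); have := ltn_ord j; rewrite /pos; lia.
have pos_inj : injective pos.
  move=> i j; case: (ltngtP i j) => [/pos_dec|/pos_dec|/val_inj //] + e;
  by rewrite e ltnn.
have groundE k (i : 'I_n) (p : 'I_m) : (k <= i)%N -> p = pos i :> nat ->
    ground lam k p = Some (i, false).
  move=> leki ep; rewrite ffunE; case: pickP => [j /andP[_ /eqP ej]|/(_ i)].
    by rewrite /= (pos_inj j i) // /pos -ej ep.
  by rewrite leki ep eqxx.
have groundP k (p : 'I_m) d : ground lam k p = Some d ->
    exists i : 'I_n, [/\ d = (i, false), (k <= i)%N & p = pos i :> nat].
  rewrite ffunE; case: pickP => [i /andP[leki /eqP ep]|] //= -[<-].
  by exists i.
have step k beta : (k <= n)%N ->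
    transfer (strips X (fun i => (i, true)) z) k (fun tau => (tau == ground lam 0)%:R) beta
    = \prod_(i < n | (i < k)%N) z i ^+ pos i * (beta == ground lam k)%:R.
  elim: k beta => [|k IHk] beta ltkn; first by rewrite big_pred0 ?mul1r.
  transitivity (\sum_tau strips X (fun i => (i, true)) z k beta tau
      * (\prod_(i < n | (i < k)%N) z i ^+ pos i) * (tau == ground lam k)%:R).
    by apply: eq_bigr => tau _; rewrite -[RHS]mulrA; congr (_ * _); apply: IHk (ltnW ltkn).
  rewrite sum_pin; pose i := Ordinal ltkn; pose p := Ordinal (lam_lt i).
  rewrite /strips (insubT (fun k => (k < n)%N) ltkn) /= -/i.
  rewrite (@rigid_strip _ _ _ _ _ _ _ _ p) //.
  - rewrite (bigD1 i (P := fun j : 'I_n => (j < k.+1)%N)) ?ltnS //= mulrC -!mulrA mulrCA.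
    congr (_ * (_ * _)).
      by apply: eq_bigl => j; rewrite ltnS ltn_neqAle andbC.
    congr ((_ == _)%:R); apply/ffunP => q; rewrite ffunE.
    have [->|nqp] := eqVneq q p.
      rewrite ffunE; case: pickP => //= j /andP[ltij /eqP ej].
      by have := pos_inj i j ej => eij; rewrite -eij ltnn in ltij.
    case Eq: (ground lam k.+1 q) => [d|].
      have [j [-> ltkj eq]] := groundP _ _ _ Eq.
      by apply: groundE => //; apply: ltnW.
    case Eq': (ground lam k q) => [d|] //.
    have [j [_ lekj eq]] := groundP _ _ _ Eq'.
    move: lekj; rewrite leq_eqVlt => /orP[/eqP ekj|ltkj]; last by rewrite (groundE _ j) in Eq.
    case/eqP: nqp; apply: val_inj; rewrite /= eq.
    by rewrite (_ : j = i) //; apply: val_inj; rewrite /= ekj.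
  - by apply: groundE.
  - move=> q ltpq; case Eq: (ground lam k q) => [d|] //.
    have [j [_ lekj eq]] := groundP _ _ _ Eq.
    move: lekj; rewrite leq_eqVlt => /orP[/eqP ekj|/(pos_dec i)]; last first.
      by rewrite -eq => /(ltn_trans ltpq); rewrite ltnn.
    by move: ltpq; rewrite eq (_ : j = i) ?ltnn //; apply: val_inj; rewrite /= ekj.
  move=> q d ltqp /groundP[j [-> lekj eq]].
  rewrite /color_lt !rank_lt /=.
  move: lekj; rewrite leq_eqVlt => /orP[/eqP ekj|] //.
  by move: ltqp; rewrite eq (_ : j = i) ?ltnn //; apply: val_inj; rewrite /= ekj.
rewrite step //; have -> : [ffun=> None] == ground lam n.
  apply/eqP/ffunP => q; rewrite ffunE.
  case Eq: (ground lam n q) => [d|] //; have [j [_ lenj _]] := groundP _ _ _ Eq.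
  by have := ltn_ord j; rewrite ltnNge lenj.
by rewrite mulr1; apply: eq_bigl => i; rewrite ltn_ord.
Qed.

End Recursion.

Lemma rmorph_partition_fun (K K' : fieldType) n m (X : cartan_type)
    (F : {rmorphism K -> K'}) (z : 'I_n -> K) (bd : boundary n m) :
  F (partition_fun X z bd) = partition_fun X (F \o z) bd.
Proof.
rewrite rmorph_sum; apply: eq_bigr => st _.
rewrite rmorph_prod; apply: eq_bigr => i _; rewrite !rmorphM; congr (_ * _ * _).
- rewrite rmorph_prod; apply: eq_bigr => j _; rewrite /Gamma_wt.
  by do ?case: hedge => [?|]; do ?case: vedge => [?|];
     do ?case: ifP => _; rewrite ?rmorph0 ?rmorph1.
- rewrite rmorph_prod; apply: eq_bigr => j _; rewrite /Delta_wt /= -fmorphV.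
  by do ?case: hedge => [?|]; do ?case: vedge => [?|];
     do ?case: ifP => _; rewrite ?rmorph0 ?rmorph1.
rewrite /Uturn_wt; do ?case: hedge => [?|]; do ?case: ifP => _;
  rewrite ?rmorph0 ?rmorph1 //.
by case: X; rewrite ?rmorphD /= !fmorphV ?rmorphXn.
Qed.

(** Here [r] stands for [z^rho], and [y / x * r] for its image under the
    exchange of [x] and [y]. *)
Lemma adjacent_recursion (F : fieldType) (x y r D D' P : F) : x != 0 -> y != x ->
  (x - y) * P = x * (r * D - (y / x) * r * D') ->
  P = r * ((D - x^-1 * y * D') / (1 - x^-1 * y)).
Proof.
move=> nzx nyx E; have nxy : x - y != 0 by rewrite subr_eq0 eq_sym.
apply: (mulfI nxy); rewrite E; field.
by rewrite nzx nxy.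
Qed.

Lemma color_lt_sbar n (c d : color n) : color_lt c d -> color_lt (sbar d) (sbar c).
Proof.
by case: c d => [i b] [j c]; rewrite /color_lt !rank_lt /sbar; case: b; case: c.
Qed.

(** The exponents of [z^rho] at adjacent indices differ by one. *)
Lemma prod_staircase_swap (F : fieldType) n (x : 'I_n -> F) (i j : 'I_n) :
  j = i.+1 :> nat -> x i != 0 ->
  \prod_k x (tperm i j k) ^+ (n - k.+1) = x j / x i * \prod_k x k ^+ (n - k.+1).
Proof.
move=> ej nzi; have nji : j != i by rewrite -val_eqE /= ej gtn_eqF.
rewrite [LHS](bigD1 i) // [in LHS](bigD1 j) //= tpermL tpermR.
rewrite [in RHS](bigD1 i) // [in RHS](bigD1 j) //= !mulrA; congr (_ * _).
  have -> : (n - i.+1)%N = (n - j.+1).+1 by have := ltn_ord j; lia.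
  by rewrite !exprS; field.
by apply: eq_bigr => k /andP[nki nkj]; rewrite tpermD // eq_sym.
Qed.

Lemma last_recursion (F : fieldType) (s r D D' P : F) : 1 - s != 0 ->
  (1 - s) * P = r * D - s * (r * D') -> P = r * ((D - s * D') / (1 - s)).
Proof. by move=> ns E; apply: (mulfI ns); rewrite E; field. Qed.

Lemma eq_strips (K : fieldType) n m (X : cartan_type) (a a' : 'I_n -> color n)
    (z z' : 'I_n -> K) q (v : {ffun 'I_m -> spin n} -> K) :
  a =1 a' -> z =1 z' -> transfer (strips X a z) q v =1 transfer (strips X a' z') q v.
Proof.
move=> ea ez; apply: eq_transfer => // k s r _; rewrite /strips.
by case: insub => // i; rewrite ea ez.
Qed.

Section Main.

Variables (R : idomainType) (X : cartan_type) (n : nat).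
Notation K := (ratfun R n).
Notation z := (@zvar R n).

Lemma demazure_opE (i : 'I_n) f :
  demazure_op X i f = (f - @root_factor R n X i * weyl_subst i f) / (1 - @root_factor R n X i).
Proof. by []. Qed.

Lemma root_factor_neq1 i : 1 - @root_factor R n X i != 0.
Proof.
rewrite subr_eq0 eq_sym /root_factor; have [[j ij ej]|[iN _]] := next_ordP i.
  rewrite ij; apply/eqP => /(congr1 ( *%R (z i))); rewrite mulVKf ?zvar_neq0 // mulr1.
  move/eqP; rewrite tofrac_eq => /eqP /mpolyX_inj /(congr1 (fun u : 'X_{1..n} => u i)).
  by rewrite !mnm1E eqxx -val_eqE /= ej gtn_eqF.
have nz1 k : (0 < k)%N -> z i ^+ k != 1.
  move=> k_gt0; rewrite -tofracXn -tofrac1 tofrac_eq; apply/eqP.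
  rewrite mpolyXn -mpolyX0 => /mpolyX_inj /(congr1 (fun u : 'X_{1..n} => u i)).
  by rewrite mulmnE mnm1E eqxx mnm0E mul1n => k0; rewrite k0 in k_gt0.
rewrite iN; case: X; rewrite invr_eq1; last exact: nz1.
by rewrite -[z i]expr1 nz1.
Qed.

Variables (m : nat) (lam : 'I_n -> nat).

(** The color that leaves the strip [i] at the left, when [w] is the product
    of [ss]. *)
Definition exit_color ss (i : 'I_n) : color n := sbar (word_fun (rev ss) (i, false)).

Lemma model_partition_fun (F : fieldType) (y : 'I_n -> F) (w : {perm signed n}) ss :
  w =1 word_fun ss ->
  partition_fun X y (model_boundary m lam w)
  = transfer (strips X (exit_color ss) y) n
      (fun tau => (tau == ground m lam 0)%:R) [ffun=> None].
Proof.
move=> wE; rewrite (@partition_funE _ _ _ _ _ (exit_color ss)) // => i.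
by rewrite /= (word_inv wE).
Qed.

Let rho (i : 'I_n) := (n - i.+1)%N%:Z.

Lemma weyl_subst_zmon i (mu : 'I_n -> nat) :
  weyl_subst i (zmon R (fun k => (mu k)%:Z)) = \prod_k act_vars i z k ^+ mu k.
Proof.
by rewrite rmorph_prod; apply: eq_bigr => k _; rewrite rmorphXn /= weyl_subst_zvar.
Qed.

Lemma zmon_rho_next i j : next_ord i = Some j ->
  weyl_subst i (zmon R rho) = z j / z i * zmon R rho.
Proof.
move=> ij; rewrite weyl_subst_zmon /act_vars ij.
have ej : j = i.+1 :> nat.
  have [[j' ij' ej']|[iN _]] := next_ordP i; last by rewrite iN in ij.
  by move: ij'; rewrite ij => -[->].
exact: prod_staircase_swap (zvar_neq0 _ _).
Qed.

Lemma zmon_rho_last i : next_ord i = None -> weyl_subst i (zmon R rho) = zmon R rho.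
Proof.
move=> iN; rewrite weyl_subst_zmon /act_vars iN; apply: eq_bigr => k _.
have [[j ij _]|[_ ei]] := next_ordP i; first by rewrite iN in ij.
by case: eqP => [->|//]; rewrite /rho ei subnn.
Qed.

Hypothesis lam_dec : forall i j : 'I_n, (i <= j)%N -> (lam j <= lam i)%N.
Hypothesis lam_lt : forall i : 'I_n, (lam i + n - i.+1 < m)%N.

Lemma partition_fun_demazure ss w : reduced_word w ss ->
  partition_fun X z (model_boundary m lam w) = zmon R rho * demazure_char R X lam ss.
Proof.
elim: ss w => [|i ss IHss] w red_w.
  rewrite (model_partition_fun _ red_w.1) ground_state //= -big_split /=.
  apply: eq_bigr => i _; rewrite -exprD; congr (_ ^+ _).
  by have := ltn_ord i; lia.
have [w' red_w'] := reduced_cons red_w.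
have pos := reduced_cons_positive red_w.
have := IHss w' red_w'.
have := congr1 (weyl_subst i) (IHss w' red_w').
rewrite rmorphM rmorph_partition_fun /= !(model_partition_fun _ red_w'.1).
rewrite (model_partition_fun _ red_w.1) /= demazure_opE => Es E.
have [[j ij ej]|[iN ei]] := next_ordP i.
  have lt_exit : color_lt (exit_color ss i) (exit_color ss j).
    move: pos; rewrite negbK (srefl_next _ ij) /= tpermL /exit_color.
    exact: color_lt_sbar.
  have nij : z j != z i.
    rewrite tofrac_eq; apply/eqP => /mpolyX_inj /(congr1 (fun u : 'X_{1..n} => u i)) /eqP.
    rewrite !mnm1E eqxx; have /negPf-> // : j != i by rewrite -val_eqE /= ej gtn_eqF.
  rewrite /root_factor ij; apply: adjacent_recursion; rewrite ?zvar_neq0 //.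
  rewrite -(zmon_rho_next ij) -Es -E.
  have exit_cons : exit_color (i :: ss) =1 exit_color ss \o tperm i j.
    by move=> k; rewrite /exit_color rev_cons word_fun_rcons (srefl_next _ ij).
  rewrite (eq_strips _ _ _ exit_cons (frefl z)).
  rewrite (exchange_adjacent X (fun tau => (tau == ground m lam 0)%:R) [ffun=> None]
    ij lt_exit (zvar_neq0 R i) (zvar_neq0 R j)).
  congr (_ * (_ - _)); apply: eq_strips => // k.
  by rewrite /= weyl_subst_zvar /act_vars ij.
have barred : (exit_color ss i).2.
  move: pos; rewrite negbK (srefl_last _ iN) /= eqxx word_fun_sbar /exit_color.
  case: (word_fun _ _) => k [] //=.
  by rewrite /sbar /color_lt rank_lt.
have rE : @root_factor R n X i = last_root_factor X (z i) by rewrite /root_factor iN.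
have := root_factor_neq1 i; rewrite rE => nr; apply: last_recursion => //.
rewrite -{2}(zmon_rho_last iN) -Es -E.
have exit_cons : exit_color (i :: ss)
    =1 fun k => if k == i then sbar (exit_color ss k) else exit_color ss k.
  move=> k; rewrite /exit_color rev_cons word_fun_rcons (srefl_last _ iN) /=.
  by case: ifP => // _; rewrite word_fun_sbar.
rewrite (eq_strips _ _ _ exit_cons (frefl z)).
rewrite (exchange_last _ iN barred (zvar_neq0 R i) nr).
congr (_ - _ * _); apply: eq_strips => // k.
by rewrite /= weyl_subst_zvar /act_vars iN.
Qed.

End Main.

Unset Implicit Arguments.

Theorem theorem4p3 (R : idomainType) (X : cartan_type) (n : nat) (hn : (1 <= n)%N)
    (lam : 'I_n -> nat)
    (hlam : forall i j : 'I_n, (i <= j)%N -> (lam j <= lam i)%N)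
    (m : nat) (hm : (lam (Ordinal hn) + n <= m)%N)
    (w : {perm signed n}) (hw : w \in Weyl n)
    (ss : seq 'I_n) (hss : reduced_word w ss) :
  partition_fun X (@zvar R n) (model_boundary m lam w)
  = zmon R (fun i : 'I_n => (n - i.+1)%N%:Z) * demazure_char R X lam ss.
Proof.
apply: partition_fun_demazure => // i.
have := hlam (Ordinal hn) i (leq0n i); have := ltn_ord i; lia.
Qed.
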